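(* Let $m\ge1$ and let $H_1:=h_m^*\in\mathcal{H}_q(\Sigma_{2m})$. Then $H_1=v^{m(2m-1)}\sum_{\epsilon\in\{\pm\}^m}I_\epsilon C_\epsilon$, where $I_\epsilon=I^{\epsilon_1}_{m\to2m-1}I^{\epsilon_2}_{m-1\to 2m-2}\cdots I^{\epsilon_m}_{1\to m}$ (the $k$-th factor being $I^{\epsilon_k}_{m+1-k\to 2m-k}$) and $C_\epsilon=\prod_{i:\ \epsilon_i=-}c_{m,m-i}$.
   Context: $K$ commutative ring, $v\in K^\times$, $q=v^2$. $\mathcal{H}^{\mathrm B}$: $K$-algebra generated by $T_0,\dots,T_{2m-1}$ with type $\mathrm B_{2m}$ braid relations, $T_0^2=1$, $T_i^2=(q-1)T_i+q$ ($i\ge1$); $\mathcal{H}=\mathcal{H}_q(\Sigma_{2m})$ is the subalgebra generated by $T_1,\dots,T_{2m-1}$; $T_w$ via reduced expressions. $T_{a\to b\to a}$ is $T_aT_{a-1}\cdots T_b\cdots T_a$ ($a>b$), $T_a$ ($a=b$), $T_a\cdots T_b\cdots T_a$ ($a<b$); $u_k^\pm=\prod_{i=0}^{k-1}(q^i\pm T_{i\to0\to i})$. $w_{m,m}\in\Sigma_{2m}$ sends $j\mapsto m+j$ and $m+j\mapsto j$ for $1\le j\le m$. $h_m$ is the unique element of $\mathcal{H}$ with $u_m^+T_{w_{m,m}}u_m^-\in u_m^+h_m+\sum_{b>m}\mathcal{H}u_b^+\mathcal{H}$ (existence and uniqueness as in the paper's definition). $*$ is the unique $K$-algebra anti-automorphism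 of $\mathcal{H}$ with $T_i^*=T_i$ for all $i$. $I_w:=v^{-\ell(w)}T_w$, $I_i:=I_{s_i}$; $I_{a\to b}:=I_aI_{a-1}\cdots I_b$ ($a>b$), $I_a$ ($a=b$), $I_aI_{a+1}\cdots I_b$ ($a<b$); $I^+_{a\to b}=I_{a\to b}$, $I^-_{a\to b}=I_{b\to a}^{-1}$. $c_{m,0}=1$, $c_{m,i}=I_{m+i\to m+1}I_{m+1\to m+i}$ ($i\ge1$), pairwise commuting. $\{\pm\}^m$ is the set of $m$-tuples of signs. *)

(* Defs.v *)
(* Iwahori-Hecke algebra of type B_n (parameters: 1 for T_0,
   q = v^2 for T_1..T_{n-1}) realized faithfully through its left regular
   representation on the free K-module with basis {T_w | w in W(B_n)}. *)
From HB Require Import structures.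
From mathcomp Require Import all_boot all_order all_algebra all_fingroup.
Import GRing.Theory.
Local Open Scope ring_scope.

Section HeckeB.
Variable n : nat.

(* Signed permutations of {1..n}.  A pair (p, e) represents the map sending
   position j+1 (j : 'I_n) to (-1)^(e j) * (p j + 1). *)
Definition W := ('S_n * {ffun 'I_n -> bool})%type.

Definition wone : W := (1%g, [ffun => false]).

(* composition w1 o w2 (apply w2 first) *)
Definition wmul (w1 w2 : W) : W :=
  ((w2.1 * w1.1)%g, [ffun j => w2.2 j (+) w1.2 (w2.1 j)]).

Definition winv (w : W) : W :=
  ((w.1^-1)%g, [ffun l => w.2 ((w.1^-1)%g l)]).

(* signed value w(j+1) *)
Definition wvalo (w : W) (j : 'I_n) : int :=
  (if w.2 j then -1 else 1) * ((w.1 j).+1)%:Z.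

Definition wval (w : W) (k : nat) : int :=
  if (insub k : option 'I_n) is Some j then wvalo w j else 0.

Definition swap_pos (a b : nat) : 'S_n :=
  match (insub a : option 'I_n), (insub b : option 'I_n) with
  | Some x, Some y => tperm x y
  | _, _ => 1%g
  end.

(* Coxeter generators: s_0 = sign change of 1, s_i = (i, i+1) for i >= 1 *)
Definition sgen (i : nat) : W :=
  if i == 0%N then (1%g, [ffun j : 'I_n => (j : nat) == 0%N])
  else (swap_pos i.-1 i, [ffun => false]).

(* s_i is a left descent of w, i.e. a right descent of u = w^-1:
   u(1) < 0 for i = 0, and u(i) > u(i+1) for i >= 1 (Bjorner-Brenti 8.1). *)
Definition ldes (i : nat) (w : W) : bool :=
  let u := winv w in
  if i == 0%N then wval u 0 < 0 else wval u i < wval u i.-1.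

Variables (K : comUnitRingType) (v : K).

Definition q : K := v ^+ 2.

Definition idx (w : W) := enum_rank w.

(* left multiplication by T_i on the basis {T_w}:
   T_s T_x = T_{sx} if l(sx) > l(x);
   otherwise T_{sx} (for s = s_0, T_0^2 = 1) or (q-1) T_x + q T_{sx}. *)
Definition Tg (i : nat) : 'M[K]_#|{: W}| :=
  \matrix_(r, c)
    (let x := enum_val c in let y := enum_val r in
     if ldes i x then
       (if i == 0%N then (y == wmul (sgen i) x)%:R
        else (q - 1) * (y == x)%:R + q * (y == wmul (sgen i) x)%:R)
     else (y == wmul (sgen i) x)%:R).

(* T_w, computed along a reduced expression (peeling off left descents) *)
Fixpoint Twf (f : nat) (w : W) : 'M[K]_#|{: W}| :=
  match f with
  | 0 => 1
  | f'.+1 =>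
      if [pick i : 'I_n | ldes i w] is Some i
      then Tg i * Twf f' (wmul (sgen i) w) else 1
  end.

Definition Tw (w : W) : 'M[K]_#|{: W}| := Twf (n * n) w.

(* coefficient of T_w in h *)
Definition coef (h : 'M[K]_#|{: W}|) (w : W) : K := h (idx w) (idx wone).

Definition hstar (h : 'M[K]_#|{: W}|) : 'M[K]_#|{: W}| :=
  \sum_(w : W) coef h w *: Tw (winv w).

Inductive inH : 'M[K]_#|{: W}| -> Prop :=
  | inH1 : inH 1
  | inHgen i : (0 < i < n)%N -> inH (Tg i)
  | inHD a b : inH a -> inH b -> inH (a + b)
  | inHM a b : inH a -> inH b -> inH (a * b)
  | inHZ (k : K) a : inH a -> inH (k *: a).

Definition Igen (i : nat) : 'M[K]_#|{: W}| := v^-1 *: Tg i.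

Definition hpath (a b : nat) : seq nat :=
  if (b <= a)%N then rev (iota b (a - b).+1) else iota a (b - a).+1.

Definition Ichain (a b : nat) : 'M[K]_#|{: W}| := \prod_(i <- hpath a b) Igen i.
Definition Iplus (a b : nat) := Ichain a b.
Definition Iminus (a b : nat) := invmx (Ichain b a).

Definition Tret (a b : nat) : 'M[K]_#|{: W}| :=
  \prod_(i <- hpath a b ++ behead (rev (hpath a b))) Tg i.

Definition uplus (k : nat) : 'M[K]_#|{: W}| :=
  \prod_(0 <= i < k) ((q ^+ i)%:M + Tret i 0).
Definition uminus (k : nat) : 'M[K]_#|{: W}| :=
  \prod_(0 <= i < k) ((q ^+ i)%:M - Tret i 0).

Definition cm (m i : nat) : 'M[K]_#|{: W}| :=
  if i == 0%N then 1 else Ichain (m + i) (m + 1) * Ichain (m + 1) (m + i).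

Inductive inJ (m : nat) : 'M[K]_#|{: W}| -> Prop :=
  | inJ0 : inJ m 0
  | inJS x a b c : inJ m x -> inH a -> inH c -> (m < b <= n)%N ->
      inJ m (x + a * uplus b * c).

(* eps k = true means eps_{k+1} = + *)
Definition Ieps (m : nat) (eps : {ffun 'I_m -> bool}) : 'M[K]_#|{: W}| :=
  \prod_(k < m)
    (if eps k then Iplus (m - k) (2 * m - 1 - k)
     else Iminus (m - k) (2 * m - 1 - k)).

Definition Ceps (m : nat) (eps : {ffun 'I_m -> bool}) : 'M[K]_#|{: W}| :=
  \prod_(k < m | ~~ eps k) cm m (m - 1 - k).

End HeckeB.

Definition wmm (n m : nat) : W n :=
  odflt (wone n) [pick w : W n | [forall j : 'I_n,
     wvalo n w j == (if ((j : nat) < m)%N then (j + m).+1 else (j - m).+1)%:Z]].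

(* Main.v *)
Require Import Defs.
From mathcomp Require Import all_boot all_order all_algebra all_fingroup.
From mathcomp Require Import zify.
Import Order.TTheory GRing.Theory Num.Theory.
Local Open Scope ring_scope.

(** Write [jm i] for the Jucys-Murphy element [T_i ... T_0 ... T_i].  The span
    of the [H u_b^+ H] with [b > m] is stable under right multiplication by
    [T_0]: [H] is a sum of [T_k ... T_1 H'] with [H'] commuting with [T_0], and
    [u_b^+ T_b ... T_1 T_0 = (u_(b+1)^+ - q^b u_b^+) (T_1 ... T_b)^-1].  Modulo
    this ideal [jm m] acts on [u_m^+] as [- q^m], so the factors [q^i - jm i] of
    [u_m^-] can be moved one at a time through
    [T_(w_(m,m)) = prod_k (T_(m+k) ... T_(k+1))]; expanding the product over sign
    vectors gives an explicit [h], whose image under [*] is the claimed sum.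

    For uniqueness, the elements [T_d u_b^+ T_w], with [d] a minimal coset
    representative of [S_n / (S_b x S_(n-b))] and [w] in [S_n], span the whole
    algebra and there are exactly [2^n n!] of them, so they form a basis adapted
    to the ideals.

    All relations in the regular representation are obtained from the right
    multiplication operators, which commute with the left ones: a matrix in the
    commutant is determined by its column at the identity. *)

(** The factors [q ^+ i - jm i] lie outside H, whereas the ideal is by definition only stable under
    H; stability under T_0 is what allows a congruence to be multiplied by the next factor. Carrying
    [jm k] leftwards through the block T_(m+k) ... T_(k+1) turns it into [jm (k + m)] and replaces
    the block by the inverse of its reversal: this is the origin of the factors I^-. As [jm (k + m)]
    is [jm m] between T_(m+k) ... T_(m+1) and the reversed word, next to u_m^+ it becomes - q^m
    times these two words, which is c_(m,k) up to a power of v; the sign cancels that of [- jm k].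
    After normalisation both signs at i carry the same scalar, q^i v^m = q^(m+i) v^(-m), so one
    power of v comes out of the whole sum. The theorem speaks of every h satisfying the congruence,
    hence the need for uniqueness. Over an arbitrary commutative ring independence comes from a
    square coordinate matrix: a right inverse, given by spanning, is also a left inverse. *)

Ltac split_ifs :=
  repeat match goal with
  | |- context [if ?b then _ else _] =>
    lazymatch b with
    | context [if _ then _ else _] => fail
    | _ => let H := fresh "H" in case H : b
    end
  end.

(** * Signed permutations: group law, one-line notation, descents *)

Section SignedPerm.
Variable n : nat.
Local Notation W := (W n).
Local Notation wone := (wone n).
Local Notation wmul := (wmul n).
Local Notation winv := (winv n).
Local Notation wval := (wval n).
Local Notation sgen := (sgen n).
Local Notation ldes := (ldes n).

Lemma wmulA : associative wmul.
Proof.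
move=> a b c; rewrite /wmul /=; congr pair; first by rewrite mulgA.
by apply/ffunP => j; rewrite !ffunE permM addbA.
Qed.

Lemma wmul1w : left_id wone wmul.
Proof.
case=> p e; rewrite /wmul /= mulg1; congr pair.
by apply/ffunP => j; rewrite !ffunE addbF.
Qed.

Lemma wmulw1 : right_id wone wmul.
Proof.
case=> p e; rewrite /wmul /= mul1g; congr pair.
by apply/ffunP => j; rewrite !ffunE perm1.
Qed.

Lemma wmulVw w : wmul (winv w) w = wone.
Proof.
rewrite /wmul /= mulgV; congr pair.
by apply/ffunP => j; rewrite !ffunE permK addbb.
Qed.

Lemma wmulwV w : wmul w (winv w) = wone.
Proof.
rewrite /wmul /= mulVg; congr pair.
by apply/ffunP => j; rewrite !ffunE addbb.
Qed.

Lemma wmul_invr a b : wmul a b = wone -> b = winv a.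
Proof. by move=> e; rewrite -[b]wmul1w -(wmulVw a) -wmulA e wmulw1. Qed.

Lemma winvK : involutive winv.
Proof. by move=> w; rewrite -(wmul_invr _ _ (wmulVw w)). Qed.

Lemma winvM a b : winv (wmul a b) = wmul (winv b) (winv a).
Proof.
by symmetry; apply: wmul_invr; rewrite wmulA -(wmulA a) wmulwV wmulw1 wmulwV.
Qed.

Lemma winv1 : winv wone = wone.
Proof. by symmetry; apply: wmul_invr; rewrite wmul1w. Qed.

Lemma wvalE w k (hk : (k < n)%N) : wval w k = wvalo n w (Ordinal hk).
Proof. by rewrite /wval insubT. Qed.

Lemma wval_ge w k : (n <= k)%N -> wval w k = 0.
Proof. by move=> h; rewrite /wval insubF // ltnNge h. Qed.

Lemma wval1 k : wval wone k = if (k < n)%N then k.+1%:Z else 0.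
Proof.
case: ltnP => [h|/wval_ge//].
by rewrite wvalE /wvalo /= ffunE mul1r perm1.
Qed.

Lemma wval_bounds w k : (k < n)%N ->
  (1 <= absz (wval w k) <= n)%N.
Proof.
move=> h; rewrite wvalE /wvalo.
have := ltn_ord (w.1 (Ordinal h)); case: (w.2 _); lia.
Qed.

Lemma wval_inj w j k : (j < n)%N -> (k < n)%N ->
  absz (wval w j) = absz (wval w k) -> j = k.
Proof.
move=> hj hk; rewrite !wvalE /wvalo => h.
have e : w.1 (Ordinal hj) = w.1 (Ordinal hk) :> nat.
  by move: h; case: (w.2 _); case: (w.2 _); lia.
by move/val_inj: e => /perm_inj [].
Qed.

Lemma wval_ext w w' : (forall k, (k < n)%N -> wval w k = wval w' k) -> w = w'.
Proof.
case: w w' => [p e] [p' e'] h.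
have h2 j : e j = e' j /\ p j = p' j.
  have := h j (ltn_ord j); rewrite !wvalE /wvalo /=.
  have -> : Ordinal (ltn_ord j) = j by apply: val_inj.
  move=> hh; split; first by move: hh; case: (e j); case: (e' j); lia.
  by apply: val_inj; move: hh => /=; case: (e j); case: (e' j); lia.
by congr pair; [apply/permP => j | apply/ffunP => j]; case: (h2 j).
Qed.

(** Positions are 0-based and values 1-based: for i >= 1, right multiplication by s_i exchanges
    positions [i.-1] and [i], while left multiplication, via [sact], exchanges the values i and i+1
    and likewise their negatives. *)
Definition swapn (i k : nat) : nat :=
  if k == i.-1 then i else if k == i then i.-1 else k.

Definition sact (i : nat) (z : int) : int :=
  if i == 0%N then (if absz z == 1%N then - z else z)
  else if z == i%:Z then i.+1%:Z else if z == i.+1%:Z then i%:Z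
  else if z == - i%:Z then - i.+1%:Z else if z == - i.+1%:Z then - i%:Z
  else z.

Variant sact_spec (t : nat) (z : int) : int -> Prop :=
  | SactFix of absz z <> t & absz z <> t.+1 : sact_spec t z z
  | SactUp of z = t%:Z : sact_spec t z t.+1%:Z
  | SactDown of z = t.+1%:Z : sact_spec t z t%:Z
  | SactUpN of z = - t%:Z : sact_spec t z (- t.+1%:Z)
  | SactDownN of z = - t.+1%:Z : sact_spec t z (- t%:Z).

Lemma sactP t z : t != 0%N -> sact_spec t z (sact t z).
Proof.
move=> t0; rewrite /sact (negbTE t0).
case: eqP => [h1|h1]; first exact: SactUp.
case: eqP => [h2|h2]; first exact: SactDown.
case: eqP => [h3|h3]; first exact: SactUpN.
case: eqP => [h4|h4]; first exact: SactDownN.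
by apply: SactFix; lia.
Qed.

Lemma sact_moved t z : t != 0%N -> z != sact t z ->
  (absz z = t /\ absz (sact t z) = t.+1) \/ (absz z = t.+1 /\ absz (sact t z) = t).
Proof. by move=> t0; case: (sactP t z t0) => [h1 h2|->|->|->|->]; lia. Qed.

Lemma sact_invol t z : t != 0%N -> sact t (sact t z) = z.
Proof.
move=> t0; case: (sactP t z t0) => [h1 h2|->|->|->|->].
- by case: (sactP t z t0); lia.
- by case: (sactP t _ t0); lia.
- by case: (sactP t _ t0); lia.
- by case: (sactP t _ t0); lia.
- by case: (sactP t _ t0); lia.
Qed.

(** Only the adjacent values t, t+1 or their negatives can change order under s_t, and such a pair
    is exchanged. *)
Lemma sact_lt t a b : t != 0%N -> absz a <> absz b ->
  (sact t a < sact t b) = (a < b) \/ (a != sact t a /\ b = sact t a).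
Proof.
move=> t0 ne; case: (sactP t a t0) => [h1 h2|ea|ea|ea|ea].
- by case: (sactP t b t0) => [h3 h4|eb|eb|eb|eb]; left; lia.
- by case: (sactP t b t0) => [h3 h4|eb|eb|eb|eb]; (left; lia) || (right; lia).
- by case: (sactP t b t0) => [h3 h4|eb|eb|eb|eb]; (left; lia) || (right; lia).
- by case: (sactP t b t0) => [h3 h4|eb|eb|eb|eb]; (left; lia) || (right; lia).
- by case: (sactP t b t0) => [h3 h4|eb|eb|eb|eb]; (left; lia) || (right; lia).
Qed.

Lemma sact0_lt a b : (0 < absz a)%N -> (0 < absz b)%N -> absz a <> absz b ->
  (sact 0 a < sact 0 b) = (a < b).
Proof. by rewrite /sact /= => ha hb ne; do 2 case: eqP; lia. Qed.

Lemma sgen_pos i (h : (0 < i < n)%N) (h1 : (i.-1 < n)%N) (h2 : (i < n)%N) :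
  sgen i = (tperm (Ordinal h1) (Ordinal h2), [ffun => false]).
Proof.
rewrite /sgen; have -> : (i == 0%N) = false by lia.
by rewrite /swap_pos !insubT.
Qed.

Lemma tperm_swapn i (h1 : (i.-1 < n)%N) (h2 : (i < n)%N) (j : 'I_n) :
  tperm (Ordinal h1) (Ordinal h2) j = swapn i j :> nat.
Proof.
rewrite /swapn; case: tpermP => [->|->|ne1 ne2] /=.
- by rewrite eqxx.
- by rewrite eqxx; case: eqP; lia.
- case: eqP => [e|_]; first by case: ne1; apply: val_inj.
  by case: eqP => [e|//]; case: ne2; apply: val_inj.
Qed.

Lemma swapn_lt i k : (0 < i < n)%N -> (swapn i k < n)%N = (k < n)%N.
Proof. by rewrite /swapn; split_ifs; lia. Qed.

Lemma wval_mulr w i k : (0 < i < n)%N ->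
  wval (wmul w (sgen i)) k = wval w (swapn i k).
Proof.
move=> h; have h2 : (i < n)%N by lia. have h1 : (i.-1 < n)%N by lia.
case: (ltnP k n) => hk; last by rewrite !wval_ge // leqNgt swapn_lt // -leqNgt.
have hk' : (swapn i k < n)%N by rewrite swapn_lt.
rewrite (sgen_pos _ h h1 h2) !wvalE /wvalo /wmul /= ffunE permM ffunE /=.
by have -> : tperm (Ordinal h1) (Ordinal h2) (Ordinal hk) = Ordinal hk'
  by apply: val_inj; rewrite /= tperm_swapn.
Qed.

Lemma wval_mulr0 w k :
  wval (wmul w (sgen 0)) k = if k == 0%N then - wval w k else wval w k.
Proof.
case: (ltnP k n) => hk; last by rewrite !wval_ge // oppr0 if_same.
rewrite !wvalE /wvalo /wmul /= ffunE permM ffunE perm1 /=.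
by case: (k == 0%N); case: (w.2 _); rewrite ?mul1r ?mulN1r ?opprK.
Qed.

Lemma wval_mull w i k : (i < n)%N ->
  wval (wmul (sgen i) w) k = sact i (wval w k).
Proof.
move=> hi; case: (ltnP k n) => hk; last first.
  by rewrite !wval_ge // /sact; case: i hi => [|i] hi //=; lia.
rewrite !wvalE /wvalo /wmul /= ffunE permM.
set x := w.1 _; set b := w.2 _.
case: (posnP i) => hi0.
  rewrite hi0 /sgen /= ffunE perm1 /sact /=.
  by case: b; case: (nat_of_ord x) => [|y] /=; lia.
have h2 : (0 < i < n)%N by rewrite hi0.
have h1 : (i.-1 < n)%N by lia.
rewrite (sgen_pos _ h2 h1 hi) /= ffunE addbF tperm_swapn /sact /swapn.
by case: b; split_ifs; lia.
Qed.

Lemma wval_inv w k : (k < n)%N ->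
  wval (winv w) (absz (wval w k)).-1 =
  if wval w k < 0 then - k.+1%:Z else k.+1%:Z.
Proof.
move=> hk; have hb := wval_bounds w k hk.
have hl : ((absz (wval w k)).-1 < n)%N by lia.
rewrite [LHS]wvalE /wvalo /winv /= ffunE.
have -> : Ordinal hl = w.1 (Ordinal hk).
  apply: val_inj => /=; rewrite wvalE /wvalo.
  by case: (w.2 _); lia.
rewrite permK wvalE /wvalo /=.
by case: (w.2 _) => /=; lia.
Qed.

Definition rdes (i : nat) (u : W) : bool :=
  if i == 0%N then wval u 0 < 0 else wval u i < wval u i.-1.

Lemma ldesE i w : ldes i w = rdes i (winv w).
Proof. by []. Qed.

Lemma winv_sgen i : (i < n)%N -> winv (sgen i) = sgen i.
Proof.
move=> hi; symmetry; apply: wmul_invr; apply: wval_ext => k hk.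
case: (posnP i) => hi0; first rewrite hi0.
  by rewrite wval_mulr0 -[sgen 0]wmul1w !wval_mulr0 !wval1; split_ifs; lia.
rewrite wval_mulr ?hi0 // -[sgen i]wmul1w wval_mulr ?hi0 // !wval1.
by rewrite /swapn; split_ifs; lia.
Qed.

Lemma sgenK i : (i < n)%N -> wmul (sgen i) (sgen i) = wone.
Proof. by move=> hi; rewrite -{1}(winv_sgen i hi) wmulVw. Qed.

Lemma wmulsK w i : (i < n)%N -> wmul (wmul w (sgen i)) (sgen i) = w.
Proof. by move=> hi; rewrite -wmulA sgenK // wmulw1. Qed.

Lemma wmulKs w i : (i < n)%N -> wmul (sgen i) (wmul (sgen i) w) = w.
Proof. by move=> hi; rewrite wmulA sgenK // wmul1w. Qed.

Lemma winv_mull w i : (i < n)%N -> winv (wmul (sgen i) w) = wmul (winv w) (sgen i).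
Proof. by move=> hi; rewrite winvM winv_sgen. Qed.

Lemma winv_mulr w i : (i < n)%N -> winv (wmul w (sgen i)) = wmul (sgen i) (winv w).
Proof. by move=> hi; rewrite winvM winv_sgen. Qed.

Lemma rdes1 i : (i < n)%N -> rdes i wone = false.
Proof. by move=> hi; rewrite /rdes !wval1; split_ifs; lia. Qed.

Lemma ldes1 i : (i < n)%N -> ldes i wone = false.
Proof. by move=> hi; rewrite ldesE winv1 rdes1. Qed.

Lemma rdes_mul i w : (i < n)%N -> rdes i (wmul w (sgen i)) = ~~ rdes i w.
Proof.
move=> hi; rewrite /rdes; case: (posnP i) => hi0.
  rewrite hi0 wval_mulr0 /=; have := wval_bounds w 0; lia.
have h : (0 < i < n)%N by rewrite hi0.
rewrite !wval_mulr // /swapn !eqxx.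
have -> : (i == i.-1) = false by lia.
have := wval_inj w i i.-1; lia.
Qed.

Lemma ldes_mul i w : (i < n)%N -> ldes i (wmul (sgen i) w) = ~~ ldes i w.
Proof. by move=> hi; rewrite !ldesE winv_mull // rdes_mul. Qed.

(* Left multiplication by s_t makes no positive root negative except the one of s_t. *)
Lemma rdes_mull i t u : (i < n)%N -> (t < n)%N ->
  rdes i (wmul (sgen t) u) = rdes i u \/ wmul (sgen t) u = wmul u (sgen i).
Proof.
move=> hi ht; case: (posnP i) => hi0.
  rewrite hi0 in hi *; have b0 := wval_bounds u 0 hi.
  rewrite /rdes /= wval_mull //.
  case: (boolP ((t == 0%N) && (absz (wval u 0) == 1%N))) => [|h]; last first.
    by left; rewrite /sact; split_ifs; lia.
  move=> /andP[/eqP t0 /eqP a1]; right; rewrite t0; apply: wval_ext => k hk.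
  rewrite wval_mull // wval_mulr0 /sact /=.
  case: (eqVneq k 0%N) => [->|k0]; first by rewrite a1.
  case: eqP => // a2; have := wval_inj u k 0 hk hi; lia.
have h : (0 < i < n)%N by rewrite hi0.
have h1 : (i.-1 < n)%N by lia.
have b0 := wval_bounds u i hi; have b1 := wval_bounds u _ h1.
have ne := wval_inj u _ _ hi h1.
rewrite /rdes; have -> : (i == 0%N) = false by lia.
rewrite !wval_mull //; case: (eqVneq t 0%N) => [->|t0].
  by left; apply: sact0_lt; lia.
have ne' : absz (wval u i) <> absz (wval u i.-1) by lia.
case: (sact_lt t _ _ t0 ne') => [|[n1 e1]]; first by left.
right; apply: wval_ext => k hk.
rewrite wval_mull // wval_mulr // /swapn.
case: eqP => [->|nk1]; first by rewrite e1 sact_invol.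
case: eqP => [->|nk2]; first by rewrite -e1.
have i1 := wval_inj u _ _ hk hi; have i2 := wval_inj u _ _ hk h1.
have := sact_moved _ _ t0 n1; rewrite -e1.
case: (eqVneq (wval u k) (sact t (wval u k))) => [<- //|n2].
move=> s1; have s2 : absz (wval u k) = absz (wval u i) \/
    absz (wval u k) = absz (wval u i.-1).
  by case: s1 => -[-> ->]; case: (sact_moved _ _ t0 n2) => -[-> _]; [left|right|right|left].
by case: s2 => [/i1|/i2].
Qed.

Lemma ldes_mulr i t w : (i < n)%N -> (t < n)%N ->
  ldes i (wmul w (sgen t)) = ldes i w \/ wmul (sgen i) w = wmul w (sgen t).
Proof.
move=> hi ht; rewrite !ldesE winv_mulr //.
case: (rdes_mull i t (winv w) hi ht) => [->|h]; [by left|right].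
by rewrite -[LHS]winvK winv_mull // -h -winv_mulr // winvK.
Qed.

(** The sign change s_0 is conjugate to no s_i with i >= 1, so the different quadratic parameters
    never conflict when a left and a right multiplication move w to the same element. *)
Lemma sgen_conj_eq0 s t w : (s < n)%N -> (t < n)%N ->
  wmul (sgen s) w = wmul w (sgen t) -> (s == 0%N) = (t == 0%N).
Proof.
move=> hs ht e; case: (posnP t) => t0.
  have := congr1 (wval^~ 0%N) e; rewrite t0 /= wval_mull // wval_mulr0 /=.
  have := wval_bounds w 0 (leq_ltn_trans (leq0n _) hs).
  by rewrite /sact; split_ifs; lia.
have := congr1 (wval^~ t) e; rewrite /= wval_mull // wval_mulr ?t0 //.
have hp : (t.-1 < n)%N by lia.
rewrite /swapn eqxx; have -> : (t == t.-1) = false by lia.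
by have := wval_inj w _ _ ht hp; rewrite /sact; split_ifs; lia.
Qed.

(** Both descents compare the length of w with that of the same element; the proof reads the values
    of the inverse off [wval_inv]. *)
Lemma ldes_rdes_conj s t w : (s < n)%N -> (t < n)%N ->
  wmul (sgen s) w = wmul w (sgen t) -> ldes s w = rdes t w.
Proof.
move=> hs ht e; have := sgen_conj_eq0 s t w hs ht e.
case: (posnP t) => t0 /=.
  move=> /eqP s0; rewrite t0 in ht e *; rewrite s0 in hs e *.
  have := congr1 (wval^~ 0%N) e; rewrite /= wval_mull // wval_mulr0 /=.
  have := wval_inv w 0 hs; have := wval_bounds w 0 hs.
  rewrite ldesE /rdes /= /sact /=; case: eqP => [->|]; last lia.
  by move=> _ ->; case: ifP; lia.
move=> s0; have hp : (t.-1 < n)%N by lia.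
have := congr1 (wval^~ t.-1) e; rewrite /= wval_mull // wval_mulr ?t0 //.
rewrite /swapn eqxx ldesE /rdes s0; have -> : (t == 0%N) = false by lia.
have := wval_inj w _ _ ht hp.
have := wval_inv w _ ht; have := wval_inv w _ hp.
set a := wval w t.-1; set b := wval w t.
move=> ha hb ne; rewrite /sact s0.
case: eqP => [ea eb|_].
  move: ha hb; rewrite -eb ea /= => -> ->; lia.
case: eqP => [ea eb|_].
  move: ha hb; rewrite -eb ea /= => -> ->; lia.
case: eqP => [ea eb|_].
  by move: ha hb; rewrite -eb ea !abszN /=; split_ifs; lia.
case: eqP => [ea eb|_]; last lia.
by move: ha hb; rewrite -eb ea !abszN /=; split_ifs; lia.
Qed.

End SignedPerm.

(** * Length function and induction along reduced words *)

Section Length.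
Variable n : nat.
Local Notation W := (W n).
Local Notation wone := (wone n).
Local Notation wmul := (wmul n).
Local Notation wval := (wval n).
Local Notation sgen := (sgen n).
Local Notation ldes := (ldes n).
Local Notation rdes := (rdes n).

(** Pairs i < j record inversions and pairs i >= j negative sums, the diagonal counting the negative
    entries. A single predicate on all ordered pairs bounds the length by n^2, the fuel of [Tw]. *)
Definition inv_pair (u : W) (i j : nat) : bool :=
  if (i < j)%N then wval u j < wval u i else wval u i + wval u j < 0.

(* Coxeter length of type B: inversions plus pairs with negative sum. *)
Definition wlen (u : W) : nat :=
  (\sum_(p : 'I_n * 'I_n) inv_pair u p.1 p.2)%N.

Lemma wlen_le u : (wlen u <= n * n)%N.
Proof.
have -> : (n * n = #|{: 'I_n * 'I_n}|)%N by rewrite card_prod card_ord.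
rewrite -sum1_card.
by apply: leq_sum => p _; case: inv_pair.
Qed.

(** Strict comparison of two counts through a matching: every element counted by g is matched to one
    counted by f, and the partner of p0 is missed. *)
Lemma sum_lt_invol (T : finType) (f g : T -> bool) (tau : T -> T) p0 :
  involutive tau -> (forall p, g (tau p) -> f p) -> f p0 -> ~~ g (tau p0) ->
  (\sum_p g p < \sum_p f p)%N.
Proof.
move=> tauK gf fp gp; rewrite (reindex_inj (inv_inj tauK)) (bigD1 p0) //=.
rewrite [X in (_ < X)%N](bigD1 p0) //= fp (negbTE gp) add0n add1n ltnS.
by apply: leq_sum => p _; case E : (g _) => //; rewrite (gf _ E).
Qed.

Lemma wlen_mulr_lt i u : (i < n)%N -> rdes i u -> (wlen (wmul u (sgen i)) < wlen u)%N.
Proof.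
move=> hi; rewrite /rdes /wlen; case: (posnP i) => hi0.
  rewrite hi0 in hi * => hu.
  pose o := Ordinal hi.
  (* Negating u(1) exchanges the inversion test at (0, j) with the negative-sum test at (j, 0), so
     [tau] transposes the pairs involving position 0; the diagonal pair is the one lost. *)
  pose tau (p : 'I_n * 'I_n) :=
    if (p.1 == o) || (p.2 == o) then (p.2, p.1) else p.
  apply: (@sum_lt_invol _ _ _ tau (o, o)).
  - move=> [x y]; rewrite /tau /=.
    case E : ((x == o) || (y == o)) => /=; first by rewrite orbC E.
    by rewrite E.
  - move=> [x y]; rewrite /tau /= -!val_eqE /inv_pair /=.
    case E : ((val x == 0%N) || (val y == 0%N)) => /=; rewrite !wval_mulr0.
      move: E; case: (eqVneq (val x) 0%N) => [->|X]; case: (eqVneq (val y) 0%N) => [->|Y] // _ /=; split_ifs; lia.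
    by split_ifs; lia.
  - by rewrite /inv_pair /=; lia.
  - by rewrite /tau /= /= /inv_pair /= wval_mulr0 /=; lia.
move=> hu; have hp : (i.-1 < n)%N by lia.
have h : (0 < i < n)%N by lia.
pose x := Ordinal hp; pose y := Ordinal hi.
have xy : (x == y) = false by rewrite -val_eqE /=; lia.
(* The pairs (x, y) and (y, x) stay fixed, since exchanging them would turn an inversion test into a
   sum test. The inversion (x, y) is the one that disappears. *)
pose tau (p : 'I_n * 'I_n) :=
  if (p == (x, y)) || (p == (y, x)) then p else (tperm x y p.1, tperm x y p.2).
apply: (@sum_lt_invol _ _ _ tau (x, y)).
- move=> p; rewrite /tau; case E : ((p == (x, y)) || (p == (y, x))).
    by rewrite E.
  case: p E => a b /=; rewrite !xpair_eqE.
  rewrite -(inj_eq (@perm_inj _ (tperm x y))) -(inj_eq (@perm_inj _ (tperm x y)) b).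
  rewrite -(inj_eq (@perm_inj _ (tperm x y)) a y) -(inj_eq (@perm_inj _ (tperm x y)) b x).
  by rewrite tpermL tpermR orbC => ->; rewrite !tpermK.
- move=> [a b]; rewrite /tau.
  case: ifP => E /=.
    by case/orP: E => /eqP[-> ->]; rewrite /inv_pair !wval_mulr // /swapn !eqxx /=;
      split_ifs; lia.
  rewrite !(tperm_swapn _ _ hp hi) /inv_pair !wval_mulr //.
  have swK k : swapn i (swapn i k) = k by rewrite /swapn; split_ifs; lia.
  rewrite !swK; have -> // : (swapn i a < swapn i b)%N = (a < b)%N.
  move: E; rewrite !xpair_eqE -!val_eqE /= /swapn; split_ifs; lia.
- by rewrite /inv_pair /=; split_ifs; lia.
- rewrite /tau eqxx /= /inv_pair !wval_mulr // /swapn !eqxx.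
  by split_ifs; lia.
Qed.

(** Without descents 0 < u(1) < ... < u(n) <= n, which forces the identity; the bounds are obtained
    by counting up from the left end and down from the right end. *)
Lemma rdes_none u : (forall i, (i < n)%N -> ~~ rdes i u) -> u = wone.
Proof.
move=> hu; apply: wval_ext => k hk; rewrite wval1 hk.
have lo j : (j < n)%N -> (j.+1%:Z <= wval u j).
  elim: j => [|j ih] hj.
    by have := wval_bounds n u 0 hj; have := hu _ hj; rewrite /rdes /=; lia.
  have := hu _ hj; rewrite /rdes /=; have hj' : (j < n)%N by lia.
  by have := ih hj'; have := wval_inj n u _ _ hj hj'; lia.
have hi j : (j < n)%N -> (wval u (n - j.+1) <= (n - j)%:Z).
  elim: j => [|j ih] hj.
    have hn : (n - 1 < n)%N by lia.
    by have := wval_bounds n u _ hn; lia.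
  have hj1 : (n - j.+1 < n)%N by lia.
  have hj2 : (n - j.+2 < n)%N by lia.
  have := hu _ hj1; rewrite /rdes.
  have -> : (n - j.+1 == 0)%N = false by lia.
  have -> : ((n - j.+1).-1 = n - j.+2)%N by lia.
  have := ih (ltnW hj); have := wval_inj n u _ _ hj1 hj2; lia.
have := lo k hk; have hk' : (n - k.+1 < n)%N by lia.
have := hi _ hk'; have -> : (n - (n - k.+1).+1 = k)%N by lia.
lia.
Qed.

Lemma W_ind_r (P : W -> Prop) : P wone ->
  (forall w t, (t < n)%N -> ~~ rdes t w -> P w -> P (wmul w (sgen t))) ->
  forall w, P w.
Proof.
move=> P1 PS w; move: {2}(wlen w).+1 (ltnSn (wlen w)) => k.
elim: k w => // k ih w hw.
case: (boolP [exists i : 'I_n, rdes i w]) => [/existsP[i hi]|/existsPn h].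
  have hin := ltn_ord i; rewrite -(wmulsK n w i) //; apply: PS => //.
    by rewrite rdes_mul // hi.
  by apply: ih; have := wlen_mulr_lt i w hin hi; lia.
by rewrite (rdes_none w) // => i hi; apply: (h (Ordinal hi)).
Qed.
End Length.

Section SquareMatrixAlgebra.
Variables (K : comUnitRingType) (N : nat).
Implicit Types (a : K) (A B : 'M[K]_N).

Lemma mxZl a A B : (a *: A) * B = a *: (A * B).
Proof. exact: esym (scalemxAl _ _ _). Qed.

Lemma mxZr a A B : A * (a *: B) = a *: (A * B).
Proof. exact: esym (scalemxAr _ _ _). Qed.

Lemma mxMv A B (x : 'cV[K]_N) : (A * B) *m x = A *m (B *m x).
Proof. exact: esym (mulmxA _ _ _). Qed.

Lemma mxcomm_scal a A : GRing.comm (a%:M) A.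
Proof. exact: comm_scalar_mx. Qed.

Lemma mxcommZ a A B : GRing.comm A B -> GRing.comm A (a *: B).
Proof. by move=> h; rewrite /GRing.comm mxZl mxZr h. Qed.

End SquareMatrixAlgebra.

(** * The regular representation and its commutant *)

Section Regular.
Variables (n : nat) (K : comUnitRingType) (v : K).
Local Notation W := (W n).
Local Notation wone := (wone n).
Local Notation wmul := (wmul n).
Local Notation winv := (winv n).
Local Notation wval := (wval n).
Local Notation sgen := (sgen n).
Local Notation ldes := (ldes n).
Local Notation rdes := (rdes n).
Local Notation q := (q K v).
Local Notation N := #|{: Defs.W n}|.
Local Notation T := (Tg n K v).
Local Notation Tw := (Tw n K v).

(** Coefficients in T_i^2 = [pa i] T_i + [pb i], so that T_0 and the other generators share the same
    formulas. *)
Definition pa (i : nat) : K := if i == 0%N then 0 else q - 1.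
Definition pb (i : nat) : K := if i == 0%N then 1 else q.

Definition bv (w : W) : 'cV[K]_N := delta_mx (idx n w) 0.

Definition Rg (i : nat) : 'M[K]_N :=
  \matrix_(r, c)
    (let x := enum_val c in let y := enum_val r in
     if rdes i x then pa i * (y == x)%:R + pb i * (y == wmul x (sgen i))%:R
     else (y == wmul x (sgen i))%:R).

Lemma bvE w r j : bv w r j = (enum_val r == w)%:R.
Proof. by rewrite mxE ord1 eqxx andbT (can2_eq enum_valK enum_rankK). Qed.

Lemma bv_combE a b w w' r j : (a *: bv w + b *: bv w') r j =
  a * (enum_val r == w)%:R + b * (enum_val r == w')%:R.
Proof. by rewrite mxE [in X in X + _]mxE [in X in _ + X]mxE !bvE. Qed.

Lemma mx_bv (A : 'M[K]_N) w r j : (A *m bv w) r j = A r (idx n w).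
Proof. by rewrite /bv -colE mxE. Qed.

Lemma mx_bv_ext (A B : 'M[K]_N) :
  (forall w, A *m bv w = B *m bv w) -> A = B.
Proof.
move=> h; apply/matrixP => r c; have := congr1 (fun x : 'cV_N => x r 0) (h (enum_val c)).
by rewrite !mx_bv /idx enum_valK.
Qed.

Lemma Tg_bv i w : T i *m bv w =
  if ldes i w then pa i *: bv w + pb i *: bv (wmul (sgen i) w)
  else bv (wmul (sgen i) w).
Proof.
apply/matrixP => r j; rewrite mx_bv mxE /= enum_rankK /pa /pb.
case: ifP => _; last by rewrite bvE.
by rewrite bv_combE; case: ifP => _; rewrite ?mul0r ?add0r ?mul1r.
Qed.

Lemma Rg_bv i w : Rg i *m bv w =
  if rdes i w then pa i *: bv w + pb i *: bv (wmul w (sgen i))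
  else bv (wmul w (sgen i)).
Proof.
apply/matrixP => r j; rewrite mx_bv mxE /= enum_rankK.
case: ifP => _; last by rewrite bvE.
by rewrite bv_combE.
Qed.

Local Opaque Tg Rg bv mulmx addmx oppmx scalemx scalar_mx.

Lemma Tg_bv_up i w : ~~ ldes i w -> T i *m bv w = bv (wmul (sgen i) w).
Proof. by move=> h; rewrite Tg_bv (negbTE h). Qed.

Lemma Rg_bv_up i w : ~~ rdes i w -> Rg i *m bv w = bv (wmul w (sgen i)).
Proof. by move=> h; rewrite Rg_bv (negbTE h). Qed.

Lemma Tg_bv_sq i w : (i < n)%N ->
  T i *m (T i *m bv w) = pa i *: (T i *m bv w) + pb i *: bv w.
Proof.
move=> hi; rewrite [T i *m bv w]Tg_bv; case: ifP => h.
  by rewrite mulmxDr -!scalemxAr !Tg_bv ldes_mul // h /= wmulKs //.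
by rewrite Tg_bv ldes_mul // h /= wmulKs //.
Qed.

Lemma Rg_bv_sq i w : (i < n)%N ->
  Rg i *m (Rg i *m bv w) = pa i *: (Rg i *m bv w) + pb i *: bv w.
Proof.
move=> hi; rewrite [Rg i *m bv w]Rg_bv; case: ifP => h.
  by rewrite mulmxDr -!scalemxAr !Rg_bv rdes_mul // h /= wmulsK //.
by rewrite Rg_bv rdes_mul // h /= wmulsK //.
Qed.

(** If s_i w = w s_j, both operators agree on [bv w] and the claim reduces to their quadratic
    relations. Otherwise neither multiplication changes the descent seen by the other, and
    associativity in W settles the four cases. *)
Lemma Tg_Rg_comm i j : (i < n)%N -> (j < n)%N -> T i * Rg j = Rg j * T i.
Proof.
move=> hi hj; apply: mx_bv_ext => w; rewrite !mxMv.
case: (eqVneq (wmul (sgen i) w) (wmul w (sgen j))) => e.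
  have ez := sgen_conj_eq0 n i j w hi hj e.
  have ep : T i *m bv w = Rg j *m bv w.
    by rewrite Tg_bv Rg_bv (ldes_rdes_conj n i j w hi hj e) e /pa /pb ez.
  by rewrite -ep Tg_bv_sq // ep Rg_bv_sq // /pa /pb ez.
have hl : ldes i (wmul w (sgen j)) = ldes i w.
  by case: (ldes_mulr n i j w hi hj) => // e'; rewrite e' eqxx in e.
have hr : rdes j (wmul (sgen i) w) = rdes j w.
  by case: (rdes_mull n j i w hj hi) => // e'; rewrite e' eqxx in e.
have lw : wmul (sgen i) (wmul w (sgen j)) = wmul (wmul (sgen i) w) (sgen j) by rewrite wmulA.
have TR : T i *m bv (wmul w (sgen j)) = if ldes i w
    then pa i *: bv (wmul w (sgen j)) + pb i *: bv (wmul (wmul (sgen i) w) (sgen j))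
    else bv (wmul (wmul (sgen i) w) (sgen j)) by rewrite Tg_bv hl lw.
have RT : Rg j *m bv (wmul (sgen i) w) = if rdes j w
    then pa j *: bv (wmul (sgen i) w) + pb j *: bv (wmul (wmul (sgen i) w) (sgen j))
    else bv (wmul (wmul (sgen i) w) (sgen j)) by rewrite Rg_bv hr.
have Tl := Tg_bv i w; have Rr := Rg_bv j w.
case: (ldes i w) TR Tl => TR Tl; case: (rdes j w) RT Rr => RT Rr; rewrite Rr Tl.
- rewrite !mulmxDr -!scalemxAr TR RT Tl Rr !scalerDr !scalerA.
  by rewrite !(mulrC (pa i)) !(mulrC (pb i)) addrACA.
- by rewrite mulmxDr -!scalemxAr TR RT Rr.
- by rewrite mulmxDr -!scalemxAr TR RT Tl.
- by rewrite TR RT.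
Qed.

Definition commR (h : 'M[K]_N) := forall j, (j < n)%N -> GRing.comm h (Rg j).

Lemma commR1 : commR 1.
Proof. by move=> j _; apply: commr_sym; apply: commr1. Qed.

Lemma commRT i : (i < n)%N -> commR (T i).
Proof. by move=> hi j hj; apply: Tg_Rg_comm. Qed.

Lemma commRM a b : commR a -> commR b -> commR (a * b).
Proof. by move=> ha hb j hj; apply: commr_sym; apply: commrM; apply: commr_sym; auto. Qed.

Lemma commRD a b : commR a -> commR b -> commR (a + b).
Proof. by move=> ha hb j hj; apply: commr_sym; apply: commrD; apply: commr_sym; auto. Qed.

Lemma commRZ k a : commR a -> commR (k *: a).
Proof. by move=> ha j hj; apply: commr_sym; apply: mxcommZ; apply: commr_sym; auto. Qed.

Lemma commR0 : commR 0.
Proof. by move=> j hj; rewrite /GRing.comm mul0r mulr0. Qed.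

Lemma commR_sum (I : Type) (r : seq I) (P : pred I) (F : I -> 'M[K]_N) :
  (forall i, P i -> commR (F i)) -> commR (\sum_(i <- r | P i) F i).
Proof. by move=> h; apply: (big_ind commR) => //; [exact: commR0 | exact: commRD]. Qed.

(** The operators [Rg] reach every [bv w] from [bv wone] along a reduced word. *)
Lemma commR_ext a b : commR a -> commR b ->
  a *m bv wone = b *m bv wone -> a = b.
Proof.
move=> ha hb e; apply: mx_bv_ext; apply: W_ind_r => // w t ht hw ih.
rewrite -(Rg_bv_up _ _ hw) -!mxMv (ha t ht) (hb t ht) !mxMv.
by rewrite ih.
Qed.

Lemma Twf_spec f w : (wlen n (winv w) <= f)%N ->
  commR (Twf n K v f w) /\ Twf n K v f w *m bv wone = bv w.
Proof.
elim: f w => [|f ih] w hw /=.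
  split; first exact: commR1.
  rewrite mul1mx; congr bv; rewrite -[w]winvK -[LHS]winv1; congr winv; symmetry.
  apply: rdes_none => i hi; apply/negP => /(wlen_mulr_lt n i _ hi); lia.
case: pickP => [i hi|h].
  have hn := ltn_ord i.
  have [|h1 h2] := ih (wmul (sgen i) w).
    by rewrite winv_mull //; have := wlen_mulr_lt n i _ hn hi; lia.
  split; first by apply: commRM => //; exact: commRT.
  by rewrite mxMv h2 Tg_bv_up ?wmulKs // ldes_mul // hi.
split; first exact: commR1.
rewrite mul1mx; congr bv; rewrite -[w]winvK -[LHS]winv1; congr winv; symmetry.
by apply: rdes_none => i hi; rewrite -ldesE (h (Ordinal hi)).
Qed.

Lemma commR_Tw w : commR (Tw w).
Proof. by have [] := Twf_spec (n * n) w (wlen_le _ _). Qed.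

Lemma Tw_bv w : Tw w *m bv wone = bv w.
Proof. by have [] := Twf_spec (n * n) w (wlen_le _ _). Qed.

Lemma Tw1 : Tw wone = 1.
Proof. by apply: commR_ext; [exact: commR_Tw | exact: commR1 | rewrite Tw_bv mul1mx]. Qed.

Lemma TgTw i w : (i < n)%N -> T i * Tw w =
  if ldes i w then pa i *: Tw w + pb i *: Tw (wmul (sgen i) w)
  else Tw (wmul (sgen i) w).
Proof.
move=> hi; have cT := commR_Tw; apply: commR_ext.
- by apply: commRM => //; apply: commRT.
- by case: ifP => _ //; apply: commRD; apply: commRZ.
rewrite mxMv Tw_bv Tg_bv; case: ifP => _; last by rewrite Tw_bv.
by rewrite mulmxDl -!scalemxAl !Tw_bv.
Qed.

Lemma TwTg i w : (i < n)%N -> Tw w * T i =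
  if rdes i w then pa i *: Tw w + pb i *: Tw (wmul w (sgen i))
  else Tw (wmul w (sgen i)).
Proof.
move=> hi; have cT := commR_Tw; apply: commR_ext.
- by apply: commRM => //; apply: commRT.
- by case: ifP => _ //; apply: commRD; apply: commRZ.
have e : T i *m bv wone = Rg i *m bv wone.
  by rewrite Tg_bv_up ?ldes1 // Rg_bv_up ?rdes1 // wmulw1 wmul1w.
rewrite mxMv e -mxMv (cT w i hi) mxMv Tw_bv Rg_bv; case: ifP => _; last by rewrite Tw_bv.
by rewrite mulmxDl -!scalemxAl !Tw_bv.
Qed.

Lemma Tw_sgen i : (i < n)%N -> Tw (sgen i) = T i.
Proof. by move=> hi; rewrite -[RHS]mulr1 -Tw1 TgTw // ldes1 // wmulw1. Qed.

Lemma commR_decomp h : commR h -> h = \sum_w coef n K h w *: Tw w.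
Proof.
move=> ch; apply: commR_ext => //.
  by apply: commR_sum => w _; apply: commRZ; apply: commR_Tw.
rewrite mulmx_suml; under eq_bigr do rewrite -scalemxAl Tw_bv.
apply/matrixP => r j; rewrite mx_bv summxE (bigD1 (enum_val r)) //= big1 => [|w hw].
  by rewrite mxE bvE eqxx mulr1 addr0 /coef /idx enum_valK.
by rewrite mxE bvE eq_sym (negbTE hw) mulr0.
Qed.

Lemma coef_Tw w w' : coef n K (Tw w) w' = (w' == w)%:R.
Proof. by rewrite /coef -(mx_bv _ _ _ 0) Tw_bv bvE /idx enum_rankK. Qed.

(** * Reduced words and the defining relations *)

Definition wprod (l : seq nat) : W := foldr (fun i w => wmul (sgen i) w) wone l.

(** One-line notation of the inverse of [wprod l], computed on [nat] without ordinals or the rank n,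
    so that equalities of words become case analysis with linear arithmetic. *)
Fixpoint uval (l : seq nat) (k : nat) : int :=
  if l is i :: l' then
    (if i == 0%N then (if k == 0%N then - uval l' k else uval l' k)
     else uval l' (swapn i k))
  else k.+1%:Z.

(** Reducedness: no letter is a left descent of the product of the letters after it. *)
Fixpoint redw (l : seq nat) : bool :=
  if l is i :: l' then
    (if i == 0%N then 0 <= uval l' 0 else uval l' i.-1 <= uval l' i) && redw l'
  else true.

Lemma wval_wprod l k : all (ltn^~ n) l -> (k < n)%N ->
  wval (winv (wprod l)) k = uval l k.
Proof.
elim: l k => [|i l ih] k /=; first by move=> _ hk; rewrite winv1 wval1 hk.
case/andP => hi hl hk; rewrite winv_mull //; case: (posnP i) => hi0.
  by rewrite hi0 wval_mulr0 ih.
by rewrite wval_mulr ?hi0 // ih // swapn_lt ?hi0.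
Qed.

Lemma Tword_bv l : all (ltn^~ n) l -> redw l ->
  (\prod_(i <- l) T i) *m bv wone = bv (wprod l).
Proof.
elim: l => [|i l ih] /=; first by rewrite big_nil mul1mx.
case/andP => hi hl /andP[hr1 hr2]; rewrite big_cons mxMv ih // Tg_bv_up //.
rewrite ldesE /rdes; case: (posnP i) hr1 => hi0 hr1.
  by rewrite wval_wprod //; lia.
rewrite !wval_wprod //; lia.
Qed.

Lemma commR_Tword l : all (ltn^~ n) l -> commR (\prod_(i <- l) T i).
Proof.
elim: l => [|i l ih] /=; first by rewrite big_nil => _; exact: commR1.
by case/andP => hi /ih hl; rewrite big_cons; apply: commRM => //; apply: commRT.
Qed.

(** Stands in for Matsumoto's theorem: both products send [bv wone] to the basis vector of the same
    element. All braid relations below are instances. *)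
Lemma Tword_eq l l' : all (ltn^~ n) l -> all (ltn^~ n) l' -> redw l -> redw l' ->
  (forall k, (k < n)%N -> uval l k = uval l' k) ->
  \prod_(i <- l) T i = \prod_(i <- l') T i.
Proof.
move=> hl hl' rl rl' e; apply: commR_ext; try exact: commR_Tword.
rewrite !Tword_bv //; congr bv; apply: (inv_inj (winvK n)).
by apply: wval_ext => k hk; rewrite !wval_wprod // e.
Qed.

Lemma prod_seq2 (R : pzRingType) (F : nat -> R) a b :
  \prod_(i <- [:: a; b]) F i = F a * F b.
Proof. by rewrite !big_cons big_nil mulr1. Qed.

Lemma prod_seq3 (R : pzRingType) (F : nat -> R) a b c :
  \prod_(i <- [:: a; b; c]) F i = F a * F b * F c.
Proof. by rewrite !big_cons big_nil mulr1 mulrA. Qed.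

Lemma prod_seq4 (R : pzRingType) (F : nat -> R) a b c d :
  \prod_(i <- [:: a; b; c; d]) F i = F a * F b * F c * F d.
Proof. by rewrite !big_cons big_nil mulr1 !mulrA. Qed.

Lemma Tg_far i j : (i.+1 < j < n)%N -> GRing.comm (T i) (T j).
Proof.
move=> h; have := Tword_eq [:: i; j] [:: j; i].
rewrite !prod_seq2; apply => /=; try lia.
all: try (move=> k hk); rewrite /swapn; split_ifs; lia.
Qed.

Lemma Tg_braid i : (0 < i)%N -> (i.+1 < n)%N ->
  T i * T i.+1 * T i = T i.+1 * T i * T i.+1.
Proof.
move=> h0 h; have := Tword_eq [:: i; i.+1; i] [:: i.+1; i; i.+1].
rewrite !prod_seq3; apply => /=; try lia.
all: try (move=> k hk); rewrite /swapn; split_ifs; lia.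
Qed.

Lemma Tg_braid0 : (1 < n)%N -> T 0 * T 1 * T 0 * T 1 = T 1 * T 0 * T 1 * T 0.
Proof.
move=> h; have := Tword_eq [:: 0; 1; 0; 1]%N [:: 1; 0; 1; 0]%N.
rewrite !prod_seq4; apply => /=; try lia.
all: try (move=> k hk); rewrite /swapn; split_ifs; lia.
Qed.

Lemma Tg_sq i : (i < n)%N -> T i * T i = pa i *: T i + (pb i)%:M.
Proof.
move=> hi; have := TgTw i (sgen i) hi; rewrite Tw_sgen // sgenK // Tw1 => ->.
by rewrite -[X in ldes i X]wmulw1 ldes_mul // ldes1 //= -scalemx1.
Qed.

End Regular.

(** * Jucys-Murphy elements in a ring satisfying the Hecke relations *)

Section HeckeRelations.
Variables (A : pzRingType) (n : nat) (q qi : A) (Z : A -> Prop) (T : nat -> A).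
Hypothesis Z_central : forall z x, Z z -> GRing.comm z x.
Hypotheses (Zq : Z q) (Zqi : Z qi) (Z1 : Z 1) (ZN : forall z, Z z -> Z (- z)).
Hypothesis n_gt0 : (0 < n)%N.
Hypothesis qqi : q * qi = 1.
Hypothesis T0_sq : T 0 * T 0 = 1.
Hypothesis T_sq : forall i, (0 < i < n)%N -> T i * T i = (q - 1) * T i + q.
Hypothesis T_far : forall i j, (i.+1 < j < n)%N -> GRing.comm (T i) (T j).
Hypothesis T_braid : forall i, (0 < i)%N -> (i.+1 < n)%N ->
  T i * T i.+1 * T i = T i.+1 * T i * T i.+1.
Hypothesis T_braid0 : (1 < n)%N -> T 0 * T 1 * T 0 * T 1 = T 1 * T 0 * T 1 * T 0.

Lemma comm_q x : GRing.comm q x. Proof. exact: Z_central. Qed.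
Lemma comm_qX k x : GRing.comm (q ^+ k) x.
Proof. by apply: commr_sym; apply: commrX; apply: commr_sym; apply: comm_q. Qed.

Fixpoint jm (i : nat) : A :=
  if i is j.+1 then T i * jm j * T i else T 0.

Definition up (a l : nat) : A := \prod_(i <- iota a l) T i.
Definition dn (a l : nat) : A := \prod_(i <- rev (iota a l)) T i.
Definition Tinv (i : nat) : A := qi * (T i - (q - 1)).
(** The inverses are taken in descending order, so this inverts [up a l] and not [dn a l]. *)
Definition dni (a l : nat) : A := \prod_(i <- rev (iota a l)) Tinv i.

Lemma iotaSr a l : iota a l.+1 = rcons (iota a l) (a + l).
Proof. by rewrite -addn1 iotaD cats1. Qed.

Lemma up0 a : up a 0 = 1. Proof. exact: big_nil. Qed.
Lemma dn0 a : dn a 0 = 1. Proof. exact: big_nil. Qed.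
Lemma dni0 a : dni a 0 = 1. Proof. exact: big_nil. Qed.
Lemma upS a l : up a l.+1 = up a l * T (a + l).
Proof. by rewrite /up iotaSr big_rcons. Qed.
Lemma dnS a l : dn a l.+1 = T (a + l) * dn a l.
Proof. by rewrite /dn iotaSr rev_rcons big_cons. Qed.
Lemma dniS a l : dni a l.+1 = Tinv (a + l) * dni a l.
Proof. by rewrite /dni iotaSr rev_rcons big_cons. Qed.
Lemma dn_cat a k l : dn a (k + l) = dn (a + k) l * dn a k.
Proof. by rewrite /dn iotaD rev_cat big_cat. Qed.

Lemma T_Tinv i : (0 < i < n)%N -> T i * Tinv i = 1.
Proof.
move=> hi; rewrite /Tinv mulrA -(Z_central qi (T i) Zqi) -mulrA mulrBr T_sq //.
have -> : T i * (q - 1) = (q - 1) * T i by rewrite mulrBr mulrBl mulr1 mul1r -comm_q.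
by rewrite addrC addKr (Z_central qi q Zqi) qqi.
Qed.

Lemma up_dni a l : (0 < a)%N -> (a + l <= n)%N -> up a l * dni a l = 1.
Proof.
move=> ha; elim: l => [|l ih] hl; first by rewrite up0 dni0 mulr1.
rewrite upS dniS -mulrA (mulrA (T _)) T_Tinv ?mul1r; last lia.
by apply: ih; lia.
Qed.

Lemma T_comm_far i j : (i < n)%N -> (j < n)%N -> (i.+1 < j)%N || (j.+1 < i)%N ->
  GRing.comm (T i) (T j).
Proof.
move=> hi hj /orP[h|h]; first by apply: T_far; lia.
by apply: commr_sym; apply: T_far; lia.
Qed.

Lemma comm_word x l : (forall i, i \in l -> GRing.comm x (T i)) ->
  GRing.comm x (\prod_(i <- l) T i).
Proof.
elim: l => [|i l ih] h; first by rewrite big_nil; apply: commr1.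
rewrite big_cons; apply: commrM; first by apply: h; rewrite mem_head.
by apply: ih => j hj; apply: h; rewrite in_cons hj orbT.
Qed.

Lemma comm_up x a l : (forall i, (a <= i < a + l)%N -> GRing.comm x (T i)) ->
  GRing.comm x (up a l).
Proof. by move=> h; apply: comm_word => i; rewrite mem_iota; apply: h. Qed.

Lemma comm_dn x a l : (forall i, (a <= i < a + l)%N -> GRing.comm x (T i)) ->
  GRing.comm x (dn a l).
Proof. by move=> h; apply: comm_word => i; rewrite mem_rev mem_iota; apply: h. Qed.

Lemma comm_Tinv x i : GRing.comm x (T i) -> GRing.comm x (Tinv i).
Proof.
move=> h; apply: commrM; first exact: commr_sym (Z_central _ _ Zqi).
by apply: commrB => //; apply: commrB; [apply: commr_sym; apply: comm_q | apply: commr1].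
Qed.

Lemma comm_dni x a l : (forall i, (a <= i < a + l)%N -> GRing.comm x (T i)) ->
  GRing.comm x (dni a l).
Proof.
elim: l => [|l ih] h; first by rewrite dni0; apply: commr1.
rewrite dniS; apply: commrM; first by apply: comm_Tinv; apply: h; lia.
by apply: ih => i hi; apply: h; lia.
Qed.

Lemma jm_shift a l : jm (a + l) = dn a.+1 l * jm a * up a.+1 l.
Proof.
elim: l => [|l ih]; first by rewrite addn0 dn0 up0 mul1r mulr1.
by rewrite addnS /= ih dnS upS addSn !mulrA.
Qed.

Lemma comm_T_jm_hi i j : (i.+1 < j < n)%N -> GRing.comm (T j) (jm i).
Proof.
elim: i => [|i ih] h /=; first by apply: T_comm_far; lia.
by apply: commrM; [apply: commrM|]; [apply: T_comm_far | apply: ih | apply: T_comm_far]; lia.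
Qed.

(** A braid move turns a into an s that can pass x, and a second one turns it back: a s a x a s = s
    a s x a s = s a x s a s = s a x a s a. *)
Lemma braid_conj_comm (a s x : A) : a * s * a = s * a * s -> GRing.comm s x ->
  GRing.comm a (s * (a * x * a) * s).
Proof.
move=> b hx; rewrite /GRing.comm !mulrA b -(mulrA (s * a) s x) hx !mulrA.
by rewrite -(mulrA (s * a * x * s) a s) -(mulrA (s * a * x) s (a * s)) (mulrA s a s) -b !mulrA.
Qed.

(** Both products expand to q t x + p t x t + q x t. With x = [jm i] and t = T_(i+1), the
    combination q jm_i + jm_(i+1) commutes with T_(i+1). *)
Lemma comm_quad_pair (t x p : A) : t * t = p * t + q -> (forall y, GRing.comm p y) ->
  GRing.comm t (q * x + t * x * t).
Proof.
move=> ht hp; rewrite /GRing.comm mulrDr mulrDl.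
have -> : t * (q * x) = q * (t * x) by rewrite mulrA -comm_q mulrA.
have -> : t * (t * x * t) = p * (t * x * t) + q * x * t.
  by rewrite !mulrA ht !mulrDl.
have -> : t * x * t * t = p * (t * x * t) + q * (t * x).
  by rewrite -mulrA ht mulrDr -comm_q mulrA -hp !mulrA.
by rewrite [LHS]addrC [RHS]addrCA -addrA.
Qed.

Lemma comm_T_jm_lo i j : (j < i < n)%N -> GRing.comm (T j) (jm i).
Proof.
elim: i j => [|i ih] j h //=.
have [hji|hji] : (j < i)%N \/ j = i by lia.
  by apply: commrM; [apply: commrM|]; [apply: T_comm_far | apply: ih | apply: T_comm_far]; lia.
rewrite hji; case: i ih h hji => [|i] ih h hji.
  by rewrite /GRing.comm /= !mulrA T_braid0 //; lia.
have b := T_braid i.+1 isT; have hc := comm_T_jm_hi i i.+2.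
by apply: braid_conj_comm; [apply: b | apply: hc]; lia.
Qed.

Lemma comm_jm i j : (i < j < n)%N -> GRing.comm (jm i) (jm j).
Proof.
move=> h; rewrite -[i]addn0; elim: i h => [|i ih] h.
  by apply: comm_T_jm_lo; lia.
rewrite addn0 /=; apply: commr_sym.
have hT : GRing.comm (jm j) (T i.+1) by apply: commr_sym; apply: comm_T_jm_lo.
apply: commrM => //; apply: commrM => //.
by apply: commr_sym; rewrite -[i]addn0; apply: ih; lia.
Qed.

Definition ujm (b : nat) : A := \prod_(0 <= i < b) (q ^+ i + jm i).

Lemma ujmS b : ujm b.+1 = ujm b * (q ^+ b + jm b).
Proof. by rewrite /ujm big_nat_recr. Qed.

Lemma ujm0 : ujm 0 = 1. Proof. by rewrite /ujm big_geq. Qed.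

Lemma comm_qXjm x k i : GRing.comm x (jm i) -> GRing.comm x (q ^+ k + jm i).
Proof. by move=> h; apply: commrD => //; apply: commr_sym; apply: comm_qX. Qed.

(** The first factor 1 + T_0 absorbs T_0, and every later factor commutes with it. *)
Lemma ujm_T0 b : (0 < b <= n)%N -> ujm b * T 0 = ujm b.
Proof.
case: b => // b; elim: b => [|b ih] h.
  by rewrite ujmS ujm0 mul1r expr0 /= mulrDl mul1r T0_sq addrC.
rewrite ujmS -mulrA.
have <- : T 0 * (q ^+ b.+1 + jm b.+1) = (q ^+ b.+1 + jm b.+1) * T 0.
  by apply: comm_qXjm; apply: comm_T_jm_lo; lia.
by rewrite mulrA ih //; lia.
Qed.

Lemma comm_ujm_hi b j : (b < j < n)%N -> GRing.comm (T j) (ujm b).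
Proof.
elim: b => [|b ih] h; first by rewrite ujm0; apply: commr1.
rewrite ujmS; apply: commrM; first by apply: ih; lia.
by apply: comm_qXjm; apply: comm_T_jm_hi; lia.
Qed.

(** The weights q^i fit exactly: the linear part is q^i (q jm_i + jm_(i+1)), covered by
    [comm_quad_pair]. In the last term the two elements may be taken in either order, so both sides
    become T jm_i T jm_i T with T = T_(i+1). *)
Lemma comm_T_pair i : (i.+1 < n)%N ->
  GRing.comm (T i.+1) ((q ^+ i + jm i) * (q ^+ i.+1 + jm i.+1)).
Proof.
move=> hi; have hc : GRing.comm (jm i) (jm i.+1) by apply: comm_jm; lia.
have hs : (0 < i.+1 < n)%N by lia.
have -> : (q ^+ i + jm i) * (q ^+ i.+1 + jm i.+1) =
   q ^+ i * q ^+ i.+1 + q ^+ i * (q * jm i + jm i.+1) + jm i * jm i.+1.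
  rewrite mulrDl !mulrDr -!addrA; congr (_ + _).
  rewrite addrCA; congr (_ + _).
  by rewrite -comm_qX exprSr mulrA.
have hq : GRing.comm (T i.+1) (q ^+ i) by apply: commr_sym; apply: comm_qX.
apply: commrD; [apply: commrD|].
- by apply: commrM => //; apply: commr_sym; apply: comm_qX.
- apply: commrM => //; apply: (comm_quad_pair _ _ (q - 1)); first exact: T_sq.
  by move=> y; apply: commr_sym; apply: commrB; [apply: commr_sym; apply: comm_q | apply: commr1].
- by rewrite /GRing.comm {2}hc /= !mulrA.
Qed.

(** T_j commutes with the factors beyond index j, with the product of those below j-1, and with the
    pair of indices j-1 and j, though not necessarily with either member of the pair. *)
Lemma comm_ujm_lo b j : (0 < j < b)%N -> (b <= n)%N -> GRing.comm (T j) (ujm b).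
Proof.
elim: b => [|b ih] hj hb; first lia.
have [h|h] : (j < b)%N \/ j = b by lia.
  rewrite ujmS; apply: commrM; first by apply: ih; lia.
  by apply: comm_qXjm; apply: comm_T_jm_lo; lia.
case: b ih hj hb h => [|b] ih hj hb h; first lia.
rewrite h 2!ujmS -mulrA; apply: commrM; first by apply: comm_ujm_hi; lia.
by apply: comm_T_pair; lia.
Qed.

(** * The subalgebra H, its cosets, and the ideals spanned by the u_b *)

Inductive subA : A -> Prop :=
  | subA1 : subA 1
  | subAT i : (0 < i < n)%N -> subA (T i)
  | subAD a b : subA a -> subA b -> subA (a + b)
  | subAM a b : subA a -> subA b -> subA (a * b)
  | subAZ z a : Z z -> subA a -> subA (z * a).

Lemma subAz z : Z z -> subA z.
Proof. by move=> hz; rewrite -[z]mulr1; apply: subAZ => //; apply: subA1. Qed.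

Lemma subAN a : subA a -> subA (- a).
Proof. by move=> ha; rewrite -mulN1r; apply: subAZ => //; apply: ZN. Qed.

Lemma subA_qX k : subA (q ^+ k).
Proof.
elim: k => [|k ih]; first by rewrite expr0; apply: subA1.
by rewrite exprS; apply: subAM => //; apply: subAz.
Qed.

Lemma subA_word l : (forall i, i \in l -> (0 < i < n)%N) -> subA (\prod_(i <- l) T i).
Proof.
elim: l => [|i l ih] h; first by rewrite big_nil; apply: subA1.
rewrite big_cons; apply: subAM; first by apply: subAT; apply: h; rewrite mem_head.
by apply: ih => j hj; apply: h; rewrite in_cons hj orbT.
Qed.

Lemma subA_up a l : (0 < a)%N -> (a + l <= n)%N -> subA (up a l).
Proof. by move=> ha hl; apply: subA_word => i; rewrite mem_iota; lia. Qed.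

Lemma subA_dn a l : (0 < a)%N -> (a + l <= n)%N -> subA (dn a l).
Proof. by move=> ha hl; apply: subA_word => i; rewrite mem_rev mem_iota; lia. Qed.

Lemma subA_Tinv i : (0 < i < n)%N -> subA (Tinv i).
Proof.
move=> hi; apply: subAZ => //; apply: subAD; first exact: subAT.
apply: subAN; apply: subAD; first exact: subAz.
by apply: subAN; apply: subA1.
Qed.

Lemma subA_dni a l : (0 < a)%N -> (a + l <= n)%N -> subA (dni a l).
Proof.
move=> ha; elim: l => [|l ih] hl; first by rewrite dni0; apply: subA1.
by rewrite dniS; apply: subAM; [apply: subA_Tinv | apply: ih]; lia.
Qed.

(* Models H as a sum of cosets of the subalgebra generated by T_2, ..., T_(n-1),
   of which only the commutation with T_0 matters. *)
Inductive cosetA : A -> Prop :=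
  | cosetA0 : cosetA 0
  | cosetAS x k y : cosetA x -> (k < n)%N -> subA y -> GRing.comm y (T 0) ->
      cosetA (x + dn 1 k * y).

Lemma cosetA_add x y : cosetA x -> cosetA y -> cosetA (x + y).
Proof.
move=> hx; elim=> [|z k w _ ih hk hw cw]; first by rewrite addr0.
by rewrite addrA; apply: cosetAS.
Qed.

Lemma cosetA_one k y : (k < n)%N -> subA y -> GRing.comm y (T 0) -> cosetA (dn 1 k * y).
Proof. by move=> *; rewrite -[_ * _]add0r; apply: cosetAS => //; apply: cosetA0. Qed.

Lemma T_dn_shift i k : (0 < i < k)%N -> (k < n)%N -> T i * dn 1 k = dn 1 k * T i.+1.
Proof.
elim: k => [|k ih] hi hk; first lia.
have [h|h] : (i < k)%N \/ i = k by lia.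
  rewrite dnS mulrA (T_comm_far i (1 + k)); [|lia..].
  by rewrite -!mulrA ih //; lia.
case: k ih hi hk h => [|k] ih hi hk h; first lia.
rewrite h 2!dnS !add1n !mulrA T_braid //.
have hc : GRing.comm (T k.+2) (dn 1 k) by apply: comm_dn => j hj; apply: T_comm_far; lia.
by rewrite -!mulrA hc.
Qed.

(** Relative to [dn 1 k], the letter T_i commutes past (i > k+1), lengthens it (i = k+1), meets the
    quadratic relation (i = k), or leaves on the right as T_(i+1) (i < k). The letters that reach y
    have index at least 2, hence commute with T_0. *)
Lemma cosetA_T i x : (0 < i < n)%N -> cosetA x -> cosetA (T i * x).
Proof.
move=> hi; elim=> [|{}x k y _ ih hk hy cy]; first by rewrite mulr0; apply: cosetA0.
rewrite mulrDr; apply: cosetA_add => //; rewrite mulrA.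
have cT j : (1 < j < n)%N -> GRing.comm (T j) (T 0).
  by move=> hj; apply: T_comm_far; lia.
have cM a b : GRing.comm a (T 0) -> GRing.comm b (T 0) -> GRing.comm (a * b) (T 0).
  by move=> ha hb; apply: commr_sym; apply: commrM; apply: commr_sym.
have [h|[h|[h|h]]] : (k.+1 < i)%N \/ i = k.+1 \/ i = k \/ (i < k)%N by lia.
- have -> : T i * dn 1 k = dn 1 k * T i.
    by apply: comm_dn => j hj; apply: T_comm_far; lia.
  rewrite -mulrA; apply: cosetA_one => //; first by apply: subAM => //; apply: subAT.
  by apply: cM => //; apply: cT; lia.
- have -> : T i * dn 1 k = dn 1 k.+1 by rewrite dnS h.
  by apply: cosetA_one => //; lia.
- case: k hk h => [|k] hk h; first lia.
  rewrite dnS add1n h mulrA T_sq; last lia.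
  have Zq1 z : GRing.comm (q - 1) z.
    by apply: commr_sym; apply: commrB; [apply: commr_sym; apply: comm_q | apply: commr1].
  have Sq1 : subA (q - 1).
    by apply: subAD; [apply: subAz | apply: subAN; apply: subA1].
  have -> : ((q - 1) * T k.+1 + q) * dn 1 k * y =
            dn 1 k.+1 * ((q - 1) * y) + dn 1 k * (q * y).
    rewrite (mulrA (dn 1 k.+1)) -Zq1 (mulrA (dn 1 k)) -comm_q dnS add1n -mulrDl.
    by rewrite (mulrA (q - 1)) -mulrDl.
  apply: cosetA_add; apply: cosetA_one => //; try lia.
  + by apply: subAM.
  + by apply: cM.
  + by apply: subAM => //; apply: subAz.
  + by apply: cM => //; apply: comm_q.
- rewrite T_dn_shift //; last lia.
  rewrite -mulrA; apply: cosetA_one => //; first by apply: subAM => //; apply: subAT; lia.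
  by apply: cM => //; apply: cT; lia.
Qed.

Lemma cosetA_subA c : subA c -> cosetA c.
Proof.
move=> hc; suff H x : cosetA x -> cosetA (c * x).
  rewrite -[c]mulr1; apply: H; rewrite -(mulr1 1) -{1}(dn0 1).
  by apply: cosetA_one => //; [apply: subA1 | apply: commr_sym; apply: commr1].
elim: hc x => [|i hi|a b _ iha _ ihb|a b _ iha _ ihb|z a hz _ iha] x hx.
- by rewrite mul1r.
- exact: cosetA_T.
- by rewrite mulrDl; apply: cosetA_add; auto.
- by rewrite -mulrA; auto.
- rewrite -mulrA; have {}hx := iha x hx.
  elim: hx => [|y k w _ ih hk hw cw]; first by rewrite mulr0; apply: cosetA0.
  rewrite mulrDr; apply: cosetA_add => //.
  rewrite mulrA (Z_central z _ hz) -mulrA; apply: cosetA_one => //; first exact: subAZ.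
  by apply: commr_sym; apply: commrM; apply: commr_sym => //; apply: Z_central.
Qed.

(** The bound [lo] is inclusive: m+1 gives the span defining h_m, while 0 gives, in the regular
    representation, a span containing every T_w, as the basis argument requires. *)
Inductive ujmI (lo : nat) : A -> Prop :=
  | ujmI0 : ujmI lo 0
  | ujmIS x a b c : ujmI lo x -> subA a -> subA c -> (lo <= b <= n)%N ->
      ujmI lo (x + a * ujm b * c).

Lemma ujmI_one lo a b c : subA a -> subA c -> (lo <= b <= n)%N -> ujmI lo (a * ujm b * c).
Proof. by move=> *; rewrite -[_ * c]add0r; apply: ujmIS => //; apply: ujmI0. Qed.

Lemma ujmI_add lo x y : ujmI lo x -> ujmI lo y -> ujmI lo (x + y).
Proof.
move=> hx; elim=> [|z a b c _ ih ha hc hb]; first by rewrite addr0.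
by rewrite addrA; apply: ujmIS.
Qed.

Lemma ujmI_subAl lo a x : subA a -> ujmI lo x -> ujmI lo (a * x).
Proof.
move=> ha; elim=> [|z a' b c _ ih ha' hc hb]; first by rewrite mulr0; apply: ujmI0.
by rewrite mulrDr !mulrA; apply: ujmIS => //; apply: subAM.
Qed.

Lemma ujmI_subAr lo a x : subA a -> ujmI lo x -> ujmI lo (x * a).
Proof.
move=> ha; elim=> [|z a' b c _ ih ha' hc hb]; first by rewrite mul0r; apply: ujmI0.
by rewrite mulrDl -mulrA; apply: ujmIS => //; apply: subAM.
Qed.

Lemma ujm_dn_T0 b : (b < n)%N ->
  ujm b * dn 1 b * T 0 = (ujm b.+1 - ujm b * q ^+ b) * dni 1 b.
Proof.
move=> hb; rewrite ujmS mulrDr addrC addrA addNr add0r -(add0n b) jm_shift !add0n /=.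
by rewrite -!mulrA up_dni ?mulr1.
Qed.

(* For k >= b the factor dn 1 b * T 0 is jm b up to a unit, by ujm_dn_T0. *)
Lemma ujmI_T0 lo x : ujmI lo x -> ujmI lo (x * T 0).
Proof.
elim=> [|z a b c _ ih ha hc hb]; first by rewrite mul0r; apply: ujmI0.
rewrite mulrDl; apply: ujmI_add => //.
elim: (cosetA_subA c hc) => [|{}x k y _ {}ih hk hy cy].
  by rewrite mulr0 mul0r; apply: ujmI0.
rewrite mulrDr mulrDl; apply: ujmI_add => //.
rewrite -!mulrA cy !mulrA.
have [kb|bk] := ltnP k b.
  (* For k < b the letters T_1, ..., T_k all commute with [ujm b], which then absorbs T_0. *)
  have hcm : ujm b * dn 1 k = dn 1 k * ujm b.
    by apply: comm_dn => j hj; apply: commr_sym; apply: comm_ujm_lo; lia.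
  rewrite -(mulrA a) hcm !mulrA -(mulrA _ _ (T 0)) ujm_T0; last lia.
  by apply: ujmI_one => //; apply: subAM => //; apply: subA_dn; lia.
have hcm : ujm b * dn (1 + b) (k - b) = dn (1 + b) (k - b) * ujm b.
  by apply: comm_dn => j hj; apply: commr_sym; apply: comm_ujm_hi; lia.
set d := dn (1 + b) (k - b).
have -> : a * ujm b * dn 1 k * T 0 * y =
    a * d * ujm b.+1 * (dni 1 b * y) + a * d * ujm b * (- (q ^+ b * (dni 1 b * y))).
  have -> : a * ujm b * dn 1 k * T 0 * y = a * d * (ujm b * dn 1 b * T 0) * y.
    by rewrite -{1}(subnKC bk) dn_cat !mulrA -(mulrA a) hcm !mulrA.
  rewrite ujm_dn_T0; last lia.
  by rewrite mulrBl mulrBr mulrBl mulrN !mulrA.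
have ha' : subA (a * d) by apply: subAM => //; apply: subA_dn; lia.
have hy' : subA (dni 1 b * y) by apply: subAM => //; apply: subA_dni; lia.
apply: ujmI_add; apply: ujmI_one => //; try lia.
by apply: subAN; apply: subAM => //; apply: subA_qX.
Qed.

Lemma ujmI_T lo i x : (i < n)%N -> ujmI lo x -> ujmI lo (x * T i).
Proof.
case: i => [_|i hi]; first exact: ujmI_T0.
by apply: ujmI_subAr; apply: subAT.
Qed.

Lemma ujmI_jm lo i x : (i < n)%N -> ujmI lo x -> ujmI lo (x * jm i).
Proof.
elim: i x => [|i ih] x hi hx /=; first exact: ujmI_T.
by rewrite !mulrA; apply: ujmI_T => //; apply: ih; [lia | apply: ujmI_T].
Qed.

Lemma ujmI_opp lo x : ujmI lo x -> ujmI lo (- x).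
Proof. by move=> hx; rewrite -mulN1r; apply: ujmI_subAl => //; apply: subAN; apply: subA1. Qed.

(** * Straightening the term attached to one sign vector *)

Section Straightening.
Variables (m : nat) (e : nat -> bool).
Hypothesis n_eq : n = (m + m)%N.
Hypothesis m_gt0 : (0 < m)%N.

Definition rest (k : nat) : A := \prod_(k <= i < m) dn i.+1 m.
Definition choice_factor (i : nat) : A := if e i then q ^+ i else - jm i.
(** Where [- jm i] is chosen, this is what minus [jm (i + m)] becomes next to u_m^+ modulo the
    ideal, the two signs cancelling. *)
Definition cfactor (i : nat) : A := if e i then 1 else q ^+ m * (dn m.+1 i * up m.+1 i).
(** What the block of index i becomes: multiplied by q^i, or, once [jm i] has crossed it, replaced
    by the inverse of its reversal ([dn_jm]). *)
Definition ifactor (i : nat) : A := if e i then q ^+ i * dn i.+1 m else dni i.+1 m.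

Lemma restS k : (k < m)%N -> rest k = dn k.+1 m * rest k.+1.
Proof. by move=> hk; rewrite /rest big_ltn. Qed.

Lemma comm_prodr (x : A) (F : nat -> A) a b :
  (forall i, (a <= i < b)%N -> GRing.comm x (F i)) ->
  GRing.comm x (\prod_(a <= i < b) F i).
Proof.
move=> h; rewrite big_seq; apply: (big_ind (GRing.comm x)).
- exact: commr1.
- by move=> *; apply: commrM.
- by move=> i; rewrite mem_index_iota; apply: h.
Qed.

Lemma subA_prod (F : nat -> A) a b :
  (forall i, (a <= i < b)%N -> subA (F i)) -> subA (\prod_(a <= i < b) F i).
Proof.
move=> h; rewrite big_seq; apply: (big_ind subA).
- exact: subA1.
- exact: subAM.
- by move=> i; rewrite mem_index_iota; apply: h.
Qed.

Lemma subA_cfactor i : (i < m)%N -> subA (cfactor i).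
Proof.
move=> hi; rewrite /cfactor; case: (e i); first exact: subA1.
apply: subAM; first exact: subA_qX.
by apply: subAM; [apply: subA_dn | apply: subA_up]; lia.
Qed.

Lemma subA_ifactor i : (i < m)%N -> subA (ifactor i).
Proof.
move=> hi; rewrite /ifactor; case: (e i); last by apply: subA_dni; lia.
by apply: subAM; [apply: subA_qX | apply: subA_dn; lia].
Qed.

Lemma comm_jm_ifactor k i : (i < k < m)%N -> GRing.comm (jm (k + m)) (ifactor i).
Proof.
move=> h; have hT j : (i.+1 <= j < i.+1 + m)%N -> GRing.comm (jm (k + m)) (T j).
  by move=> hj; apply: commr_sym; apply: comm_T_jm_lo; lia.
rewrite /ifactor; case: (e i); last exact: comm_dni.
by apply: commrM; [apply: commr_sym; apply: comm_qX | apply: comm_dn].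
Qed.

Lemma comm_ujm_cfactor i : (i < m)%N -> GRing.comm (ujm m) (cfactor i).
Proof.
move=> h; have hT j : (m.+1 <= j < m.+1 + i)%N -> GRing.comm (ujm m) (T j).
  by move=> hj; apply: commr_sym; apply: comm_ujm_hi; lia.
rewrite /cfactor; case: (e i); first exact: commr1.
apply: commrM; first by apply: commr_sym; apply: comm_qX.
by apply: commrM; [apply: comm_dn | apply: comm_up].
Qed.

Lemma comm_jm_rest k : (k < m)%N -> GRing.comm (jm k) (rest k.+1).
Proof.
move=> hk; apply: comm_prodr => i hi; apply: comm_dn => j hj.
by apply: commr_sym; apply: comm_T_jm_hi; lia.
Qed.

Lemma dn_jm k : (k < m)%N -> dn k.+1 m * jm k = jm (k + m) * dni k.+1 m.
Proof. by move=> hk; rewrite jm_shift -!mulrA up_dni ?mulr1 //; lia. Qed.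

(* Modulo the ideal, jm m acts on ujm m as - q ^+ m, because
   ujm m.+1 = ujm m * (q ^+ m + jm m). *)
Lemma ujm_jm_mod k : (k < m)%N ->
  ujmI m.+1 (ujm m * jm (k + m) + ujm m * (q ^+ m * (dn m.+1 k * up m.+1 k))).
Proof.
move=> hk; rewrite addnC jm_shift.
have hc : ujm m * dn m.+1 k = dn m.+1 k * ujm m.
  by apply: comm_dn => j hj; apply: commr_sym; apply: comm_ujm_hi; lia.
have -> : ujm m * (dn m.+1 k * jm m * up m.+1 k) +
    ujm m * (q ^+ m * (dn m.+1 k * up m.+1 k)) = dn m.+1 k * ujm m.+1 * up m.+1 k.
  have -> : ujm m * (dn m.+1 k * jm m * up m.+1 k) = dn m.+1 k * (ujm m * jm m) * up m.+1 k.
    by rewrite !mulrA hc.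
  have -> : ujm m * (q ^+ m * (dn m.+1 k * up m.+1 k)) =
      dn m.+1 k * (ujm m * q ^+ m) * up m.+1 k.
    rewrite -(comm_qX m (ujm m)) !mulrA -(comm_qX m (ujm m)) -(comm_qX m (dn _ _)).
    by rewrite -(mulrA _ (ujm m) (dn _ _)) hc !mulrA.
  by rewrite -mulrDl -mulrDr addrC -mulrDr -ujmS.
by apply: ujmI_one; [apply: subA_dn | apply: subA_up |]; lia.
Qed.

(** Invariant after k factors: the first k blocks are rewritten and [rest k] is untouched. The new
    [jm (k + m)] commutes with the earlier I-factors, whose letters have index below k+m, and u_m^+
    commutes with the C-factors, so the two can be made adjacent. *)
Lemma straighten k : (k <= m)%N ->
  ujmI m.+1 (ujm m * rest 0 * \prod_(0 <= i < k) choice_factor i -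
    ujm m * (\prod_(0 <= i < k) cfactor i * \prod_(0 <= i < k) ifactor i) * rest k).
Proof.
elim: k => [|k ih] hk; first by rewrite !big_geq // !mulr1 subrr; apply: ujmI0.
rewrite !big_nat_recr //=.
set F := \prod_(0 <= i < k) choice_factor i.
set C := \prod_(0 <= i < k) cfactor i; set I := \prod_(0 <= i < k) ifactor i.
have {}ih := ih (ltnW hk); rewrite (restS k) // in ih.
have hC : subA C by apply: subA_prod => i hi; apply: subA_cfactor; lia.
have hI : subA I by apply: subA_prod => i hi; apply: subA_ifactor; lia.
have hr : subA (rest k.+1) by apply: subA_prod => i hi; apply: subA_dn; lia.
rewrite /choice_factor /cfactor /ifactor; case: (e k).
  rewrite mulr1; set X := (X in ujmI _ X).
  suff -> : X = (ujm m * rest 0 * F - ujm m * (C * I) * (dn k.+1 m * rest k.+1)) * q ^+ k.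
    by apply: ujmI_subAr => //; apply: subA_qX.
  rewrite /X mulrBl !mulrA; congr (_ - _).
  by rewrite -[in RHS]comm_qX -(comm_qX k (ujm m * C * I)) !mulrA.
have cI : jm (k + m) * I = I * jm (k + m).
  by apply: comm_prodr => i hi; apply: comm_jm_ifactor; lia.
have cC : ujm m * C = C * ujm m.
  by apply: comm_prodr => i hi; apply: comm_ujm_cfactor; lia.
have cr := comm_jm_rest k hk.
set c := q ^+ m * _.
have hD : subA (dni k.+1 m) by apply: subA_dni; lia.
set Y := _ - _ in ih.
have e1 : ujm m * (C * I) * (dn k.+1 m * rest k.+1) * jm k =
    C * (ujm m * jm (k + m)) * (I * dni k.+1 m * rest k.+1).
  have e0 : dn k.+1 m * rest k.+1 * jm k = jm (k + m) * dni k.+1 m * rest k.+1.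
    by rewrite -mulrA -cr mulrA dn_jm.
  by rewrite -mulrA e0 !mulrA -cC -(mulrA _ (jm _) I) cI !mulrA.
have e2 : ujm m * (C * c * (I * dni k.+1 m)) * rest k.+1 =
    C * (ujm m * c) * (I * dni k.+1 m * rest k.+1) by rewrite !mulrA cC.
have -> : ujm m * rest 0 * (F * - jm k) - ujm m * (C * c * (I * dni k.+1 m)) * rest k.+1 =
   Y * - jm k - C * (ujm m * jm (k + m) + ujm m * c) * (I * dni k.+1 m * rest k.+1).
  rewrite mulrDr mulrDl -e1 -e2 /Y mulrBl !mulrN opprK opprD addrA addrK -!mulrA.
  by [].
(* The first summand is the previous congruence times [- jm k], which contains T_0 and so needs
   stability beyond H; the second is [ujm_jm_mod] between elements of H. *)
apply: ujmI_add.
  by rewrite mulrN; apply: ujmI_opp; apply: ujmI_jm => //; lia.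
apply: ujmI_opp; apply: ujmI_subAr; last by apply: ujmI_subAl => //; apply: ujm_jm_mod.
by do 2?apply: subAM.
Qed.
End Straightening.

Definition ffun_nat (m : nat) (eps : {ffun 'I_m -> bool}) (i : nat) : bool :=
  oapp eps false (insub i).

Lemma ffun_natE m (eps : {ffun 'I_m -> bool}) (i : 'I_m) : ffun_nat m eps i = eps i.
Proof. by rewrite /ffun_nat valK. Qed.

Definition straight (m : nat) (e : nat -> bool) : A :=
  \prod_(0 <= i < m) cfactor m e i * \prod_(0 <= i < m) ifactor m e i.

Lemma straighten_sum m : n = (m + m)%N -> (0 < m)%N ->
  ujmI m.+1 (ujm m * rest m 0 * \prod_(0 <= i < m) (q ^+ i - jm i) -
    ujm m * \sum_(eps : {ffun 'I_m -> bool}) straight m (ffun_nat m eps)).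
Proof.
move=> hn hm.
have -> : \prod_(0 <= i < m) (q ^+ i - jm i) =
    \sum_(eps : {ffun 'I_m -> bool}) \prod_(0 <= i < m) choice_factor (ffun_nat m eps) i.
  rewrite big_mkord; under eq_bigr => i _.
    rewrite -[_ - _](_ : \sum_(b : bool) (if b then q ^+ i else - jm i) = _); last first.
      by rewrite big_bool.
    over.
  rewrite bigA_distr_bigA; apply: eq_bigr => eps _; rewrite big_mkord.
  by apply: eq_bigr => i _; rewrite /choice_factor ffun_natE.
rewrite !mulr_sumr -sumrB; apply: (big_ind (ujmI m.+1)).
- exact: ujmI0.
- exact: ujmI_add.
move=> eps _; have := straighten m (ffun_nat m eps) hn hm m (leqnn m).
by rewrite /rest (big_geq (leqnn m)) mulr1.
Qed.

End HeckeRelations.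

(** * A reduced word for the block swap *)

Section BlockSwap.
Variable m : nat.

Definition block_word (k : nat) : seq nat :=
  flatten [seq rev (iota i.+1 m) | i <- iota k (m - k)].

(** One-line notation of the inverse once j letters of block k are placed in front: the entry k+1
    has moved from position k to position k+j. *)
Definition block_val (k j p : nat) : int :=
  (if (p < k)%N then p.+1%:Z
   else if (p < k + j)%N then (p.+1 + m)%:Z - k%:Z
   else if p == (k + j)%N then k.+1%:Z
   else if (p < k.+1 + m)%N then (p + m)%:Z - k%:Z
   else p.+1%:Z - m%:Z).

Lemma block_word_step l k j :
  (k < m)%N -> (j <= m)%N -> redw l ->
  (forall p, (p < 2 * m)%N -> uval l p = block_val k 0 p) ->
  redw (rev (iota k.+1 j) ++ l) /\
  (forall p, (p < 2 * m)%N -> uval (rev (iota k.+1 j) ++ l) p = block_val k j p).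
Proof.
move=> hk + rl hl; elim: j => [|j ih] hj; first by [].
rewrite iotaSr rev_rcons /=; case: (ih (ltnW hj)) => h1 h2; split.
  by rewrite h1 andbT !h2 /block_val; [split_ifs; lia | lia..].
move=> p hp; rewrite h2; last by rewrite /swapn; split_ifs; lia.
by rewrite /block_val /swapn; split_ifs; lia.
Qed.

Lemma block_wordP k : (k <= m)%N -> redw (block_word k) /\
  (forall p, (p < 2 * m)%N -> uval (block_word k) p =
    if (p < k)%N then p.+1%:Z else if (p < k + m)%N then (p.+1 + m)%:Z - k%:Z
    else p.+1%:Z - m%:Z).
Proof.
move=> hk; rewrite -(subKn hk); have := leq_subr k m; move: (m - k)%N => j {k hk}.
elim: j => [|j ih] hj.
  by rewrite /block_word subn0 subnn /=; split=> // p hp; split_ifs; lia.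
have [h1 h2] := ih (ltnW hj).
have hkm : (m - j.+1 < m)%N by lia.
have e : block_word (m - j.+1) = rev (iota (m - j.+1).+1 m) ++ block_word (m - j).
  rewrite /block_word; have -> : (m - (m - j.+1) = (m - (m - j)).+1)%N by lia.
  by rewrite /= ; have -> : ((m - j.+1).+1 = m - j)%N by lia.
have [|r1 r2] := block_word_step (block_word (m - j)) _ m hkm (leqnn m) h1.
  by move=> p hp; rewrite h2 // /block_val; split_ifs; lia.
rewrite e; split=> // p hp; rewrite r2 // /block_val; split_ifs; lia.
Qed.

Lemma block_word_lt : all (ltn^~ (2 * m)%N) (block_word 0).
Proof.
apply/allP => i /flatten_mapP[k]; rewrite mem_iota mem_rev mem_iota /=; lia.
Qed.

Lemma wprod_wmm : wprod (2 * m) (block_word 0) = wmm (2 * m) m.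
Proof.
set n := (2 * m)%N; set w := wprod n _.
have [_ hu] := block_wordP 0 (leq0n m).
have hw k : (k < n)%N -> wval n w k = if (k < m)%N then (k + m).+1%:Z else k.+1%:Z - m%:Z.
  (* [uval] describes the inverse, so w(k) is recovered from the position p where the inverse takes
     the value k+1. *)
  move=> hk; pose p := if (k < m)%N then (k + m)%N else (k - m)%N.
  have hp : (p < n)%N by rewrite /p /n in hk *; split_ifs; lia.
  have := wval_inv n (winv n w) p hp; rewrite winvK (wval_wprod _ _ _ block_word_lt) // hu //.
  rewrite /p add0n subr0; case: (ltnP k m) => hkm.
    have -> : (k + m < m)%N = false by lia.
    have -> : (k + m).+1%:Z - m%:Z = k.+1 by lia.
    by rewrite /= => ->.
  have -> : (k - m < m)%N by rewrite /n in hk; lia.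
  have -> : ((k - m).+1 + m)%:Z = k.+1%:Z by lia.
  by rewrite /= => ->; lia.
rewrite /wmm; case: pickP => [w' /forallP hw'|h] /=.
  apply: wval_ext => k hk; rewrite hw // wvalE (eqP (hw' _)) /=.
  by split_ifs; lia.
have := h w; move=> /negP[]; apply/forallP => j; apply/eqP.
have := hw j (ltn_ord j); rewrite wvalE.
have -> : Ordinal (ltn_ord j) = j by apply: val_inj.
by move=> ->; split_ifs; lia.
Qed.
End BlockSwap.

(** * Minimal coset representatives *)

Section CosetReps.
Variable n : nat.
Implicit Types (f : nat -> bool) (e : {ffun 'I_n -> bool}).

Definition ones f k := count f (iota 0 k).

(** Stable sorting that puts the marked positions first. Its inverse is increasing on the first b
    places and on the remaining ones, b being the number of marks, which characterises minimal
    representatives. *)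
Definition rep_pos f k := if f k then ones f k else (ones f n + (k - ones f k))%N.

Lemma onesS f k : ones f k.+1 = (ones f k + f k)%N.
Proof. by rewrite /ones -addn1 iotaD count_cat /= addn0. Qed.

Lemma ones_mono f k l : (k <= l)%N -> (ones f k <= ones f l <= ones f k + (l - k))%N.
Proof.
move=> h; rewrite -(subnKC h); elim: (l - k)%N => [|d ih]; first by rewrite addn0; lia.
by rewrite addnS onesS; case: (f _); lia.
Qed.

Lemma ones_le f k : (ones f k <= k)%N.
Proof. by have := ones_mono f 0 k (leq0n k); rewrite /(ones f 0) /=; lia. Qed.

Lemma rep_pos_lt f k : (k < n)%N -> (rep_pos f k < n)%N.
Proof.
move=> hk; rewrite /rep_pos.
have := ones_mono f _ _ hk; rewrite onesS; have := ones_le f n; have := ones_le f k.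
by case: (f k); lia.
Qed.

Lemma rep_pos_inj_lt f k l : (k < l < n)%N -> rep_pos f k <> rep_pos f l.
Proof.
move=> /andP[hkl hln]; rewrite /rep_pos.
have := ones_mono f _ _ hkl; rewrite onesS.
have := ones_mono f _ _ hln; rewrite onesS.
have := ones_le f k; have := ones_le f l.
by case: (f k); case: (f l); lia.
Qed.

Lemma rep_pos_inj f k l : (k < n)%N -> (l < n)%N -> rep_pos f k = rep_pos f l -> k = l.
Proof.
move=> hk hl h; have h1 := rep_pos_inj_lt f k l; have h2 := rep_pos_inj_lt f l k.
case: (ltngtP k l) => hkl //; first by case: h1; rewrite ?hkl.
by case: h2; rewrite ?hkl.
Qed.

Definition wA (s : 'S_n) : W n := (s, [ffun => false]).

Definition rep_ord e (k : 'I_n) : 'I_n := Ordinal (rep_pos_lt (ffun_nat n e) k (ltn_ord k)).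

Lemma rep_ord_inj e : injective (rep_ord e).
Proof.
by move=> k l /(congr1 val) /= h; apply: val_inj; apply: rep_pos_inj h.
Qed.

Definition coset_rep e : W n := winv n (wA (perm (rep_ord_inj e))).

Lemma wval_wA s k (hk : (k < n)%N) : wval n (wA s) k = (s (Ordinal hk)).+1%:Z.
Proof. by rewrite wvalE /wvalo /= ffunE mul1r. Qed.

Lemma wval_rep e k : (k < n)%N ->
  wval n (winv n (coset_rep e)) k = (rep_pos (ffun_nat n e) k).+1%:Z.
Proof. by move=> hk; rewrite winvK (wval_wA _ _ hk) permE. Qed.

Lemma sgen_A i s : (0 < i < n)%N -> exists s', wmul n (sgen n i) (wA s) = wA s'.
Proof.
move=> hi; have h1 : (i.-1 < n)%N by lia. have h2 : (i < n)%N by lia.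
rewrite (sgen_pos n i hi h1 h2); eexists; rewrite /wmul /wA /=; congr pair.
by apply/ffunP => j; rewrite !ffunE.
Qed.

Definition nones e := ones (ffun_nat n e) n.

Lemma nones_le e : (nones e <= n)%N. Proof. exact: ones_le. Qed.

(** One half of Deodhar's dichotomy for s_i times a representative: exchanging two different marks
    gives another representative for the same b. *)
Lemma coset_rep_diff i e : (0 < i < n)%N -> ffun_nat n e i.-1 != ffun_nat n e i ->
  exists2 e', nones e' = nones e & wmul n (sgen n i) (coset_rep e) = coset_rep e'.
Proof.
move=> hi ne; have h1 : (i.-1 < n)%N by lia. have h2 : (i < n)%N by lia.
pose e' := [ffun j => e (tperm (Ordinal h1) (Ordinal h2) j)]; exists e'.
all: set f := ffun_nat n e in ne *; set f' := ffun_nat n e'.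
all: have ff k : (k < n)%N -> f' k = f (swapn i k).
1,3: move=> hk; rewrite /f' /f /ffun_nat insubT /= ffunE.
1,2: have hs : (swapn i k < n)%N by rewrite swapn_lt.
1,2: by rewrite insubT /=; congr (e _); apply: val_inj; rewrite /= tperm_swapn.
(* The prefix counts of the two markings can differ only at length i. *)
all: have c1 k : (k < i)%N -> ones f' k = ones f k.
1,3: move=> hk; apply: eq_in_count => l; rewrite mem_iota => hl; rewrite ff; last lia.
1,2: by congr f; rewrite /swapn; split_ifs; lia.
all: have fi : f' i = f i.-1 by rewrite ff // /swapn; split_ifs; (lia || congr f; lia).
all: have fp : f' i.-1 = f i by rewrite ff // /swapn eqxx.
all: have oi g : ones g i = (ones g i.-1 + g i.-1)%N by rewrite -onesS prednK //; lia.
all: have c2 k : (i < k <= n)%N -> ones f' k = ones f k.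
1,3: elim: k => [|k ih] hk; first lia.
1,2: have [e1|e1] : k = i \/ (i < k)%N by lia.
1,3: by rewrite e1 !onesS !oi fi fp c1; lia.
1,2: rewrite !onesS ih ?ff; [|lia..].
1,2: by have -> : swapn i k = k by rewrite /swapn; split_ifs; lia.
  by rewrite /nones -/f -/f' c2 //; lia.
have cn : ones f' n = ones f n by apply: c2; lia.
rewrite -[LHS]winvK -[RHS]winvK; congr winv; rewrite winv_mull //.
apply: wval_ext => k hk; rewrite wval_mulr // !wval_rep ?swapn_lt // -/f -/f'; congr (Posz _.+1).
have [e1|[e1|e1]] : k = i.-1 \/ k = i \/ (k < i.-1)%N || (i < k)%N by lia.
- rewrite e1 /rep_pos fp cn c1; last lia.
  have -> : swapn i i.-1 = i by rewrite /swapn eqxx.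
  have := ones_le f i.-1; rewrite oi; move: ne; case: (f i); case: (f i.-1); lia.
- rewrite e1 /rep_pos fi cn !oi fp c1; last lia.
  have -> : swapn i i = i.-1 by rewrite /swapn; split_ifs; lia.
  have := ones_le f i.-1; move: ne; case: (f i); case: (f i.-1); lia.
- have sk : swapn i k = k by rewrite /swapn; split_ifs; lia.
  rewrite /rep_pos ff // sk cn.
  have -> // : ones f' k = ones f k.
  by case/orP: e1 => e1; [apply: c1 | apply: c2]; lia.
Qed.

(** The other half: for equal marks, s_i crosses the representative as some s_j in S_b x S_(n-b).
    The condition that j differs from b is what lets T_j commute with u_b^+. *)
Lemma coset_rep_same i e : (0 < i < n)%N -> ffun_nat n e i.-1 = ffun_nat n e i ->
  ~~ ldes n i (coset_rep e) /\
  exists2 j, (0 < j < n)%N && (j != nones e) &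
    wmul n (sgen n i) (coset_rep e) = wmul n (coset_rep e) (sgen n j).
Proof.
set f := ffun_nat n e => hi ne.
have h1 : (i.-1 < n)%N by lia. have h2 : (i < n)%N by lia.
have oi : ones f i = (ones f i.-1 + f i.-1)%N by rewrite -onesS prednK //; lia.
have hS : rep_pos f i = (rep_pos f i.-1).+1.
  by rewrite /rep_pos oi ne; have := ones_le f i.-1; case: (f i); lia.
split.
  rewrite ldesE /rdes; have -> : (i == 0%N) = false by lia.
  by rewrite !wval_rep // -/f hS; lia.
exists (rep_pos f i).
  have := rep_pos_lt f i h2; rewrite hS => -> /=.
  rewrite -hS /nones -/f /rep_pos; have := ones_mono f _ _ h2; rewrite onesS oi ne.
  by have := ones_le f i.-1; case: (f i); lia.
set j := rep_pos f i; have hj : (0 < j < n)%N by rewrite rep_pos_lt // andbT /j hS.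
have hjn : (j < n)%N by lia.
rewrite -[LHS]winvK -[RHS]winvK; congr winv; rewrite winv_mull // winv_mulr //.
apply: wval_ext => k hk; rewrite wval_mulr // wval_mull // !wval_rep ?swapn_lt // -/f.
have i1 := rep_pos_inj f k i hk h2; have i2 := rep_pos_inj f k i.-1 hk h1.
have [e1|[e1|e1]] : k = i.-1 \/ k = i \/ (k < i.-1)%N || (i < k)%N by lia.
- have -> : swapn i k = i by rewrite e1 /swapn eqxx.
  by rewrite e1 /sact -/j; move: hS; rewrite -/j => ->; split_ifs; lia.
- have -> : swapn i k = i.-1 by rewrite e1 /swapn; split_ifs; lia.
  by rewrite e1 /sact -/j; move: hS; rewrite -/j => ->; split_ifs; lia.
- have -> : swapn i k = k by rewrite /swapn; split_ifs; lia.
  rewrite /sact /j; split_ifs; lia.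
Qed.

Definition init_ones b : {ffun 'I_n -> bool} := [ffun j : 'I_n => (j < b)%N].

Lemma ones_init b k : (k <= n)%N -> ones (ffun_nat n (init_ones b)) k = minn k b.
Proof.
elim: k => [|k ih] hk; first by rewrite min0n.
rewrite onesS ih ?(ltnW hk) // /ffun_nat insubT /= ffunE /=; case: (ltnP k b); lia.
Qed.

Lemma nones_init b : (b <= n)%N -> nones (init_ones b) = b.
Proof. by move=> hb; rewrite /nones ones_init //; lia. Qed.

Lemma coset_rep_init b : (b <= n)%N -> coset_rep (init_ones b) = wone n.
Proof.
move=> hb; rewrite -[LHS]winvK -[RHS]winvK; congr winv; rewrite winv1.
apply: wval_ext => k hk; rewrite wval_rep // wval1 hk /rep_pos !ones_init //; last exact: ltnW.
by rewrite /ffun_nat insubT /= ffunE /=; case: (ltnP k b) => ?; congr (Posz _.+1); lia.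
Qed.
End CosetReps.

(** * Spans of finite families *)

Section Span.
Variables (K : comUnitRingType) (V : lmodType K).

Definition spans (I : finType) (P : pred I) (F : I -> V) (x : V) :=
  exists k : I -> K, x = \sum_(i | P i) k i *: F i.

Lemma spans0 (I : finType) (P : pred I) (F : I -> V) : spans I P F 0.
Proof. by exists (fun=> 0); rewrite big1 // => i _; rewrite scale0r. Qed.

Lemma spansD (I : finType) (P : pred I) (F : I -> V) x y :
  spans I P F x -> spans I P F y -> spans I P F (x + y).
Proof.
move=> [k ->] [l ->]; exists (fun i => k i + l i).
by rewrite -big_split /=; apply: eq_bigr => i _; rewrite scalerDl.
Qed.

Lemma spansZ (I : finType) (P : pred I) (F : I -> V) a x :
  spans I P F x -> spans I P F (a *: x).
Proof.
move=> [k ->]; exists (fun i => a * k i).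
by rewrite scaler_sumr; apply: eq_bigr => i _; rewrite scalerA.
Qed.

Lemma spans_gen (I : finType) (P : pred I) (F : I -> V) i : P i -> spans I P F (F i).
Proof.
move=> hi; exists (fun j => (j == i)%:R); rewrite (bigD1 i) //= eqxx scale1r.
by rewrite big1 ?addr0 // => j /andP[_ /negbTE->]; rewrite scale0r.
Qed.

Lemma spans_ind (I : finType) (P : pred I) (F : I -> V) (Q : V -> Prop) :
  Q 0 -> (forall x y, Q x -> Q y -> Q (x + y)) -> (forall a x, Q x -> Q (a *: x)) ->
  (forall i, P i -> Q (F i)) -> forall x, spans I P F x -> Q x.
Proof.
move=> Q0 QD QZ QF x [k ->]; apply: (big_ind Q) => // i hi.
by apply: QZ; apply: QF.
Qed.

Lemma spans_sub (I : finType) (P P' : pred I) (F : I -> V) x :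
  (forall i, P i -> P' i) -> spans I P F x -> spans I P' F x.
Proof.
move=> h; apply: (spans_ind _ _ _ (spans I P' F)).
- exact: spans0.
- by move=> *; apply: spansD.
- by move=> *; apply: spansZ.
- by move=> i hi; apply: spans_gen; apply: h.
Qed.
End Span.
Arguments spans {K V I}.

Lemma spansM (K : comUnitRingType) (N : nat) (I J : finType) (P : pred I) (P' : pred J)
    (F : I -> 'M[K]_N) (F' : J -> 'M[K]_N) (a x : 'M[K]_N) :
  (forall i, P i -> spans P' F' (a * F i)) -> spans P F x -> spans P' F' (a * x).
Proof.
move=> h; apply: (@spans_ind _ _ _ _ _ (fun x => spans P' F' (a * x))) => [|y z hy hz|k y hy|//].
- by rewrite mulr0; apply: spans0.
- by rewrite mulrDr; apply: spansD.
- by rewrite mxZr; apply: spansZ.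
Qed.

(** * Transfer to the regular representation, and the adapted basis *)

Section Instance.
Variables (n : nat) (K : comUnitRingType) (v : K).
Hypothesis v_unit : v \is a GRing.unit.
Hypothesis n_gt0 : (0 < n)%N.
Local Notation W := (W n).
Local Notation wone := (wone n).
Local Notation wmul := (wmul n).
Local Notation winv := (winv n).
Local Notation sgen := (sgen n).
Local Notation ldes := (ldes n).
Local Notation rdes := (rdes n).
Local Notation q := (q K v).
Local Notation N := #|{: Defs.W n}|.
Local Notation T := (Tg n K v).
Local Notation Tw := (Tw n K v).

Definition HA : pzRingType := 'M[K]_N.

Definition qm : HA := q%:M.
Definition qim : HA := q^-1%:M.
Definition scalar_set (z : HA) := exists k : K, z = k%:M.

Local Notation jmM := (jm HA T).
Local Notation ujmM := (ujm HA qm T).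
Local Notation subM := (subA HA n scalar_set T).
Local Notation idealM := (ujmI HA n qm scalar_set T).

Lemma scalar_central (z x : HA) : scalar_set z -> GRing.comm z x.
Proof. by move=> [k ->]; apply: mxcomm_scal. Qed.

Lemma scalar_q : scalar_set qm. Proof. by exists q. Qed.
Lemma scalar_qi : scalar_set qim. Proof. by exists q^-1. Qed.
Lemma scalar_1 : scalar_set 1. Proof. by exists 1. Qed.
Lemma scalar_opp (z : HA) : scalar_set z -> scalar_set (- z).
Proof. by move=> [k ->]; exists (- k); rewrite raddfN. Qed.

Lemma q_unit : q \is a GRing.unit.
Proof. by rewrite /Defs.q unitrX. Qed.

Lemma qqiM : qm * qim = 1.
Proof. by rewrite /qm /qim -[LHS]scalar_mxM divrr // q_unit. Qed.

Lemma T0_sqM : (T 0 : HA) * T 0 = 1.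
Proof.
by have := Tg_sq n K v 0 n_gt0; rewrite /pa /pb /= scale0r add0r.
Qed.

Lemma T_sqM i : (0 < i < n)%N -> (T i : HA) * T i = (qm - 1) * T i + qm.
Proof.
case/andP=> h0 hi; have := Tg_sq n K v i hi; rewrite /pa /pb eqn0Ngt h0 /=.
move=> e; rewrite [LHS]e; congr (_ + _).
by rewrite -[LHS]mul_scalar_mx /qm; congr (_ * _); rewrite raddfB.
Qed.

Lemma T_farM i j : (i.+1 < j < n)%N -> GRing.comm (T i : HA) (T j).
Proof. exact: Tg_far. Qed.

Lemma T_braidM i : (0 < i)%N -> (i.+1 < n)%N ->
  (T i : HA) * T i.+1 * T i = (T i.+1 : HA) * T i * T i.+1.
Proof. exact: Tg_braid. Qed.

Lemma T_braid0M : (1 < n)%N ->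
  (T 0 : HA) * T 1 * T 0 * T 1 = (T 1 : HA) * T 0 * T 1 * T 0.
Proof. exact: Tg_braid0. Qed.

Lemma comm_ujmM b j : (0 < j < n)%N -> j != b -> (b <= n)%N ->
  GRing.comm (T j : HA) (ujmM b).
Proof.
move=> hj ne hb; have [h|h] : (j < b)%N \/ (b < j)%N by lia.
  apply: (comm_ujm_lo HA n qm scalar_set T scalar_central scalar_q n_gt0 T_sqM T_farM
    T_braidM T_braid0M b j _ hb); lia.
apply: (comm_ujm_hi HA n qm scalar_set T scalar_central scalar_q n_gt0 T_farM T_braid0M b j); lia.
Qed.

Lemma ideal_T lo i (x : HA) : (i < n)%N -> idealM lo x -> idealM lo (x * T i).
Proof.
exact: (ujmI_T HA n qm qim scalar_set T scalar_central scalar_q scalar_qi scalar_1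
  scalar_opp n_gt0 qqiM T0_sqM T_sqM T_farM T_braidM T_braid0M).
Qed.

Lemma up_dniM a l : (0 < a)%N -> (a + l <= n)%N ->
  up HA T a l * dni HA qm qim T a l = 1.
Proof.
exact: (up_dni HA n qm qim scalar_set T scalar_central scalar_q scalar_qi n_gt0 qqiM
  T_sqM T_braid0M).
Qed.

Lemma inH_sub (a : HA) : inH n K v a -> subM a.
Proof.
elim=> [|i hi|{}a b _ iha _ ihb|{}a b _ iha _ ihb|k {}a _ iha].
- exact: subA1.
- exact: subAT.
- exact: subAD.
- exact: subAM.
- by rewrite -mul_scalar_mx; apply: (subAZ HA n scalar_set T k%:M a) => //; exists k.
Qed.

Lemma sub_inH (a : HA) : subM a -> inH n K v a.
Proof.
elim=> [|i hi|{}a b _ iha _ ihb|{}a b _ iha _ ihb|z {}a [k ->] _ iha].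
- exact: inH1.
- exact: inHgen.
- exact: inHD.
- exact: inHM.
- by have := inHZ n K v k a iha; rewrite -mul_scalar_mx.
Qed.

Lemma qmX i : qm ^+ i = (q ^+ i)%:M.
Proof.
elim: i => [|i ih]; first by rewrite !expr0.
by rewrite !exprS ih /qm -[LHS]scalar_mxM.
Qed.

Lemma Tret_jm i : Tret n K v i 0 = jmM i.
Proof.
rewrite /Tret /hpath leq0n subn0 revK big_cat /= -[i in RHS]add0n jm_shift.
rewrite rev_cons -cats1 big_cat /= big_cons big_nil.
congr (_ * _); congr (_ * _); exact: mulr1.
Qed.

Lemma uplus_ujm b : uplus n K v b = ujmM b.
Proof. by apply: eq_bigr => i _; rewrite qmX Tret_jm. Qed.

Lemma uminus_jm b : uminus n K v b = \prod_(0 <= i < b) (qm ^+ i - jmM i).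
Proof. by apply: eq_bigr => i _; rewrite qmX Tret_jm. Qed.

Lemma inJ_ideal m (x : HA) : inJ n K v m x <-> idealM m.+1 x.
Proof.
split; elim=> [|{}x a b c _ ih ha hc hb].
- exact: ujmI0.
- by rewrite uplus_ujm; apply: ujmIS => //; apply: inH_sub.
- exact: inJ0.
- by rewrite -uplus_ujm; apply: inJS => //; apply: sub_inH.
Qed.

Definition TA (s : 'S_n) : HA := Tw (wA n s).

Lemma inH_TA s : inH n K v (TA s).
Proof.
rewrite /TA /Defs.Tw; elim: (n * n)%N s => [|f ih] s /=; first exact: inH1.
case: pickP => [i hi|_]; last exact: inH1.
have hin := ltn_ord i.
have hi0 : (0 < i)%N.
  case: (posnP i) => // i0; move: hi; rewrite ldesE /rdes i0 /= /winv /=.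
  by rewrite (wvalE _ _ _ n_gt0) /wvalo /= !ffunE /=; lia.
have hi' : (0 < i < n)%N by lia.
apply: inHM; first exact: inHgen.
by have [s' ->] := sgen_A n i s hi'; apply: ih.
Qed.

Local Notation spanA := (spans (V := 'M[K]_N) predT TA).

Lemma spanA_T i x : (0 < i < n)%N -> spanA x -> spanA (T i * x).
Proof.
move=> hi; apply: spansM => s _.
have hin : (i < n)%N by lia.
rewrite /TA TgTw //; have [s' ->] := sgen_A n i s hi.
case: ifP => _; last exact: spans_gen.
by apply: spansD; apply: spansZ; apply: (spans_gen _ _ _ predT TA).
Qed.

Lemma wA1 : wA n 1%g = wone.
Proof. by []. Qed.

Lemma inH_spanA c : inH n K v c -> spanA c.
Proof.
move=> hc; suff H x : spanA x -> spanA (c * x).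
  rewrite -[c]mulr1; apply: H.
  by rewrite -(Tw1 n K v) -wA1; apply: (spans_gen _ _ _ predT TA).
elim: hc x => [|i hi|a b _ iha _ ihb|a b _ iha _ ihb|k a _ iha] x hx.
- by rewrite mul1r.
- exact: spanA_T.
- by rewrite mulrDl; apply: spansD; auto.
- by rewrite -mulrA; auto.
- by rewrite mxZl; apply: spansZ; auto.
Qed.

(* Basis of the whole algebra adapted to the ideals: the sign part of the
   index selects a coset representative and, by its number of ones, ujmM. *)
Definition adapted (x : W) : HA :=
  Tw (coset_rep n x.2) * ujmM (nones n x.2) * TA x.1.

Definition nones_is (b : nat) (x : W) := nones n x.2 == b.

Local Notation spanE b := (spans (V := 'M[K]_N) (nones_is b) adapted).

Lemma spanE_coset e c : inH n K v c ->
  spanE (nones n e) (Tw (coset_rep n e) * ujmM (nones n e) * c).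
Proof.
move/inH_spanA; apply: spansM => s _.
by apply: (spans_gen _ _ _ (nones_is (nones n e)) adapted (s, e)); rewrite /nones_is.
Qed.

(** Deodhar's dichotomy in the algebra: T_i either acts among the representatives with the same b,
    or crosses as a T_j that passes u_b^+ and is absorbed by the factor in H. *)
Lemma spanE_T b i x : (0 < i < n)%N -> spanE b x -> spanE b (T i * x).
Proof.
move=> hi; apply: spansM => -[s e] /eqP /= <-.
have hin : (i < n)%N by lia.
rewrite /adapted /=.
have hTA := inH_TA s.
have -> : T i * (Tw (coset_rep n e) * ujmM (nones n e) * TA s) =
    T i * Tw (coset_rep n e) * ujmM (nones n e) * TA s.
  by rewrite !(@mulrA HA).
case: (eqVneq (ffun_nat n e i.-1) (ffun_nat n e i)) => [same|diff].
  have [nd [j /andP[hj hjn] ej]] := coset_rep_same n i e hi same.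
  have hjn' : (j < n)%N by lia.
  have nr : ~~ rdes j (coset_rep n e) by rewrite -(ldes_rdes_conj n i j _ hin hjn' ej).
  rewrite TgTw // (negbTE nd) ej.
  have -> : Tw (wmul (coset_rep n e) (sgen j)) = Tw (coset_rep n e) * T j.
    by rewrite TwTg // (negbTE nr).
  have hc : (T j : HA) * ujmM (nones n e) = ujmM (nones n e) * T j.
    by apply: comm_ujmM => //; apply: nones_le.
  have -> : Tw (coset_rep n e) * T j * ujmM (nones n e) * TA s =
     Tw (coset_rep n e) * ujmM (nones n e) * (T j * TA s).
    by rewrite !(@mulrA HA) -(@mulrA HA (Tw _)) hc !(@mulrA HA).
  by apply: spanE_coset; apply: inHM => //; apply: inHgen.
have [e' ne' ->] : exists2 e', nones n e' = nones n e &
    T i * Tw (coset_rep n e) = if ldes i (coset_rep n e) then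
      pa K v i *: Tw (coset_rep n e) + pb K v i *: Tw (coset_rep n e') else Tw (coset_rep n e').
  have [e' h1 h2] := coset_rep_diff n i e hi diff.
  by exists e' => //; rewrite TgTw // h2.
have h' := spanE_coset e' _ hTA; rewrite ne' in h'.
case: ifP => _ //; rewrite !mulrDl !mxZl.
by apply: spansD; apply: spansZ => //; apply: spanE_coset.
Qed.

Lemma spanE_ujm a b c : inH n K v a -> inH n K v c -> (b <= n)%N ->
  spanE b (a * ujmM b * c).
Proof.
move=> ha hc hb; suff H x : spanE b x -> spanE b (a * x).
  rewrite -(@mulrA HA); apply: H.
  have := spanE_coset (init_ones n b) c hc.
  by rewrite coset_rep_init // Tw1 nones_init // (@mul1r HA).
elim: ha x => [|i hi|a1 a2 _ ih1 _ ih2|a1 a2 _ ih1 _ ih2|k a1 _ ih1] x hx.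
- by rewrite mul1r.
- exact: spanE_T.
- by rewrite mulrDl; apply: spansD; auto.
- by rewrite -mulrA; auto.
- by rewrite mxZl; apply: spansZ; auto.
Qed.

Lemma ideal_span lo x : idealM lo x ->
  spans (V := 'M[K]_N) (fun w : W => lo <= nones n w.2)%N adapted x.
Proof.
elim=> [|{}x a b c _ ih /sub_inH ha /sub_inH hc /andP[hb1 hb2]]; first exact: spans0.
apply: spansD => //; have := spanE_ujm a b c ha hc hb2.
by apply: spans_sub => w /eqP ->.
Qed.

(** The ideal with [lo] equal to 0 contains u_0^+ = 1 and is stable under every T_i on the right.
    Hence the adapted elements span all T_w. *)
Lemma ideal0_Tw w : idealM 0 (Tw w).
Proof.
elim/W_ind_r: w => [|w t ht hr ih].
  rewrite Tw1.
  have -> : (1 : HA) = 1 * ujmM 0 * 1 by rewrite ujm0 !mulr1.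
  by apply: ujmI_one; [exact: subA1 | exact: subA1 | lia].
by have := ideal_T 0 t _ ht ih; have := TwTg n K v t w ht; rewrite (negbTE hr) => <-.
Qed.

Definition adapted_mx : 'M[K]_N :=
  \matrix_(r, c) adapted (enum_val c) r (idx n wone).

(* The |W| adapted elements span the free module of rank |W|, hence they are a basis. *)
Lemma adapted_free (k : W -> K) : \sum_w k w *: adapted w = 0 :> 'M[K]_N -> forall w, k w = 0.
Proof.
move=> hk.
have /fin_all_exists[c hc] (w : W) : exists c : W -> K, Tw w = \sum_x c x *: adapted x :> 'M[K]_N.
  have [c e] := ideal_span 0 _ (ideal0_Tw w).
  by exists c; rewrite e; apply: eq_bigl => x.
pose C : 'M[K]_N := \matrix_(r, s) c (enum_val s) (enum_val r).
have MC : adapted_mx *m C = 1%:M.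
  apply/matrixP => r s; rewrite !mxE.
  transitivity (coef n K (Tw (enum_val s)) (enum_val r)); last first.
    by rewrite coef_Tw (inj_eq enum_val_inj).
  rewrite /coef hc summxE [RHS](reindex_onto enum_val enum_rank) /=; last by move=> w _; apply: enum_rankK.
  apply: eq_big => [j|j _]; first by rewrite enum_valK eqxx.
  by rewrite !mxE /idx enum_valK mulrC.
have CM := mulmx1C MC.
pose a : 'cV[K]_N := \col_j k (enum_val j).
have Ma : adapted_mx *m a = 0.
  apply/matrixP => r j; rewrite !mxE.
  transitivity (\sum_w (k w *: adapted w : 'M[K]_N) r (idx n wone)); last first.
    by rewrite -summxE hk mxE.
  rewrite [RHS](reindex_onto enum_val enum_rank) /=; last by move=> w _; apply: enum_rankK.
  apply: eq_big => [l|l _]; first by rewrite enum_valK eqxx.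
  by rewrite !mxE mulrC.
have a0 : a = 0 by rewrite -[a]mul1mx -CM -mulmxA Ma mulmx0.
move=> w; have := congr1 (fun X : 'cV[K]_N => X (enum_rank w) 0) a0.
by rewrite !mxE enum_rankK.
Qed.

(** In the adapted basis u_m^+ h involves only vectors with m marks and the ideal only vectors with
    more, so independence kills every coefficient of h. *)
Lemma ujm_inH_ideal_eq0 m h : (m <= n)%N -> inH n K v h ->
  idealM m.+1 (ujmM m * h) -> h = 0.
Proof.
move=> hm /inH_spanA[b hb] /ideal_span[a ha].
have ub : ujmM m * h = \sum_s b s *: adapted (s, init_ones n m) :> 'M[K]_N.
  rewrite hb mulr_sumr; apply: eq_bigr => s _.
  by rewrite mxZr /adapted /= coset_rep_init // Tw1 nones_init // (@mul1r HA).
pose k (w : W) := (if (m < nones n w.2)%N then a w else 0)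
  - (if w.2 == init_ones n m then b w.1 else 0).
have k0 : \sum_w k w *: adapted w = 0 :> 'M[K]_N.
  under eq_bigr do rewrite scalerBl; rewrite sumrB.
  have -> : \sum_w (if (m < nones n w.2)%N then a w else 0) *: adapted w = ujmM m * h :> 'M[K]_N.
    rewrite ha [RHS]big_mkcond; apply: eq_bigr => w _; case: ifP => _ //; exact: scale0r.
  rewrite ub; apply/eqP; rewrite subr_eq0; apply/eqP.
  rewrite (eq_bigr (fun w : W => (if w.2 == init_ones n m then b w.1 else 0) *: adapted (w.1, w.2)));
    last by case.
  rewrite -(pair_bigA _ (fun s e => (if e == init_ones n m then b s else 0) *: adapted (s, e))) /=.
  apply: eq_bigr => s _; rewrite (bigD1 (init_ones n m)) //= eqxx big1 ?addr0 //.
  by move=> e /negbTE ->; rewrite scale0r.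
rewrite hb big1 // => s _; have := adapted_free k k0 (s, init_ones n m).
rewrite /k /= nones_init // ltnn eqxx sub0r => /eqP; rewrite oppr_eq0 => /eqP ->.
exact: scale0r.
Qed.
End Instance.

(** * The anti-automorphism *)

Section Star.
Variables (n : nat) (K : comUnitRingType) (v : K).
Local Notation N := #|{: Defs.W n}|.
Local Notation T := (Tg n K v).
Local Notation Tw := (Tw n K v).
Local Notation hstar := (hstar n K v).
Local Notation inH := (inH n K v).
Local Notation commR := (commR n K v).

Lemma hstarD a b : hstar (a + b) = hstar a + hstar b.
Proof.
rewrite /Defs.hstar -big_split /=; apply: eq_bigr => w _.
by rewrite -scalerDl /coef mxE.
Qed.

Lemma hstarZ k a : hstar (k *: a) = k *: hstar a.
Proof.
rewrite /Defs.hstar scaler_sumr; apply: eq_bigr => w _.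
by rewrite scalerA /coef mxE.
Qed.

Lemma hstar0 : hstar 0 = 0.
Proof. by have := hstarZ 0 0; rewrite !scale0r. Qed.

Lemma hstar_sum (I : Type) (r : seq I) (P : pred I) (F : I -> 'M[K]_N) :
  hstar (\sum_(i <- r | P i) F i) = \sum_(i <- r | P i) hstar (F i).
Proof. exact: (big_morph hstar hstarD hstar0). Qed.

Lemma hstar_Tw w : hstar (Tw w) = Tw (winv n w).
Proof.
rewrite /Defs.hstar (bigD1 w) //= coef_Tw eqxx scale1r big1 ?addr0 // => w' hw.
by rewrite coef_Tw (negbTE hw) scale0r.
Qed.

Lemma hstar1 : hstar 1 = 1.
Proof. by rewrite -(Tw1 n K v) hstar_Tw winv1. Qed.

Lemma hstar_T i : (i < n)%N -> hstar (T i) = T i.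
Proof. by move=> hi; rewrite -(Tw_sgen n K v i hi) hstar_Tw winv_sgen. Qed.

(** The tables [TgTw] and [TwTg] are mirror images under inversion in W. Membership in the commutant
    allows b to be expanded in the T_w, since [hstar] sees only the identity column. *)
Lemma hstar_TM i b : (i < n)%N -> commR b -> hstar (T i * b) = hstar b * T i.
Proof.
move=> hi hb; rewrite {1}(commR_decomp n K v b hb) mulr_sumr hstar_sum /Defs.hstar mulr_suml.
apply: eq_bigr => w _; rewrite -/(hstar _) mxZr hstarZ mxZl; congr (_ *: _).
rewrite TgTw // TwTg // -ldesE -winv_mull //; case: ifP => _; last by rewrite hstar_Tw.
by rewrite hstarD !hstarZ !hstar_Tw.
Qed.

Lemma inH_commR a : inH a -> commR a.
Proof.
elim=> [|i hi|{}a b _ iha _ ihb|{}a b _ iha _ ihb|k {}a _ iha].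
- exact: commR1.
- by apply: commRT; lia.
- exact: commRD.
- exact: commRM.
- exact: commRZ.
Qed.

Lemma hstarM a b : inH a -> commR b -> hstar (a * b) = hstar b * hstar a.
Proof.
move=> ha; elim: ha b => [|i hi|a1 a2 h1 ih1 h2 ih2|a1 a2 h1 ih1 h2 ih2|k a1 h1 ih1] b hb.
- by rewrite hstar1 mul1r mulr1.
- have hin : (i < n)%N by lia.
  by rewrite hstar_TM // hstar_T.
- by rewrite mulrDl !hstarD mulrDr ih1 // ih2.
- have c2 := inH_commR _ h2.
  have c2b := commRM _ _ _ _ _ c2 hb.
  by rewrite -mulrA (ih1 _ c2b) (ih2 _ hb) (ih1 _ c2) mulrA.
- by rewrite mxZl !hstarZ ih1 // mxZr.
Qed.

Lemma inH_prod (I : eqType) (l : seq I) (F : I -> 'M[K]_N) :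
  (forall i, i \in l -> inH (F i)) -> inH (\prod_(i <- l) F i).
Proof.
elim: l => [|i l ih] h; first by rewrite big_nil; apply: inH1.
rewrite big_cons; apply: inHM; first by apply: h; rewrite mem_head.
by apply: ih => j hj; apply: h; rewrite in_cons hj orbT.
Qed.

Lemma hstar_prod (I : eqType) (l : seq I) (F : I -> 'M[K]_N) :
  (forall i, i \in l -> inH (F i)) ->
  hstar (\prod_(i <- l) F i) = \prod_(i <- rev l) hstar (F i).
Proof.
elim: l => [|i l ih] h; first by rewrite !big_nil hstar1.
have hl : forall j, j \in l -> inH (F j) by move=> j hj; apply: h; rewrite in_cons hj orbT.
rewrite big_cons hstarM; last 2 first.
- by apply: h; rewrite mem_head.
- by apply: inH_commR; apply: inH_prod.
by rewrite ih // rev_cons big_rcons.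
Qed.

Lemma rev_iota0 m : rev (iota 0 m) = [seq (m - 1 - k)%N | k <- iota 0 m].
Proof.
apply: (@eq_from_nth _ 0%N); first by rewrite size_rev size_map.
move=> i; rewrite size_rev size_iota => hi.
rewrite nth_rev size_iota // (nth_map 0%N) ?size_iota // !nth_iota //; lia.
Qed.

Lemma hstar_prod_nat m (F : nat -> 'M[K]_N) : (forall i, (i < m)%N -> inH (F i)) ->
  hstar (\prod_(0 <= i < m) F i) = \prod_(k < m) hstar (F (m - 1 - k)%N).
Proof.
move=> h; rewrite hstar_prod; last by move=> i; rewrite mem_index_iota; apply: h.
by rewrite /index_iota subn0 rev_iota0 big_map -[iota 0 m]/(iota 0 m) -{1}(subn0 m)
  -/(index_iota 0 m) big_mkord.
Qed.

Lemma prod_mxZ (I : Type) (l : seq I) (P : pred I) (c : I -> K) (F : I -> 'M[K]_N) :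
  \prod_(i <- l | P i) (c i *: F i) = (\prod_(i <- l | P i) c i) *: \prod_(i <- l | P i) F i.
Proof.
elim: l => [|i l ih]; first by rewrite !big_nil scale1r.
by rewrite !big_cons ih; case: (P i) => //; rewrite mxZl mxZr scalerA.
Qed.

Lemma invmx_eq (A B : 'M[K]_N) : A *m B = 1%:M -> invmx A = B.
Proof.
move=> h; have [uA _] := mulmx1_unit h.
by rewrite -[LHS]mulmx1 -h mulmxA mulVmx // mul1mx.
Qed.
End Star.

(** * Normalisation from T to I, and the closed formula *)

Section Compute.
Variables (m : nat) (K : comUnitRingType) (v : K).
Hypothesis v_unit : v \is a GRing.unit.
Hypothesis m_gt0 : (0 < m)%N.
Local Notation n := (2 * m)%N.
Local Notation N := #|{: Defs.W n}|.
Local Notation q := (q K v).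
Local Notation T := (Tg n K v).
Local Notation HA := (HA n K).
Local Notation qm := (qm n K v).
Local Notation qim := (qim n K v).
Local Notation hstar := (hstar n K v).
Local Notation inH := (inH n K v).
Local Notation upM := (up HA T).
Local Notation dnM := (dn HA T).
Local Notation dniM := (dni HA qm qim T).

Lemma n_gt0 : (0 < n)%N. Proof. lia. Qed.
Lemma n_eq : n = (m + m)%N. Proof. lia. Qed.

Lemma inH_up a l : (0 < a)%N -> (a + l <= n)%N -> inH (upM a l).
Proof. by move=> ha hl; apply: inH_prod => i; rewrite mem_iota => hi; apply: inHgen; lia. Qed.

Lemma inH_dn a l : (0 < a)%N -> (a + l <= n)%N -> inH (dnM a l).
Proof. by move=> ha hl; apply: inH_prod => i; rewrite mem_rev mem_iota => hi; apply: inHgen; lia. Qed.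

Lemma hstar_word l : (forall i, i \in l -> (0 < i < n)%N) ->
  hstar (\prod_(i <- l) T i) = \prod_(i <- rev l) T i.
Proof.
move=> h; rewrite hstar_prod => [|i hi]; last by apply: inHgen; apply: h.
rewrite big_seq [RHS]big_seq; apply: eq_bigr => i; rewrite mem_rev => /h /andP[_].
exact: hstar_T.
Qed.

Lemma hstar_dn a l : (0 < a)%N -> (a + l <= n)%N -> hstar (dnM a l) = upM a l.
Proof.
move=> ha hl; rewrite [LHS]hstar_word; first by rewrite revK.
by move=> i; rewrite mem_rev mem_iota; lia.
Qed.

Lemma hstar_up a l : (0 < a)%N -> (a + l <= n)%N -> hstar (upM a l) = dnM a l.
Proof. by move=> ha hl; rewrite [LHS]hstar_word // => i; rewrite mem_iota; lia. Qed.

Lemma inH_dni a l : (0 < a)%N -> (a + l <= n)%N -> inH (dniM a l).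
Proof.
move=> ha hl; apply: sub_inH.
exact: (subA_dni HA n qm qim (scalar_set n K) T (scalar_q n K v) (scalar_qi n K v)
  (scalar_1 n K) (scalar_opp n K) n_gt0 (T_braid0M n K v)).
Qed.

(** The image under [hstar] of [up_dniM] is a left inverse of [dnM a l], hence a two-sided one for
    square matrices. This identifies the starred inverse block with I^- up to a power of v. *)
Lemma hstar_dni_dn a l : (0 < a)%N -> (a + l <= n)%N ->
  dnM a l *m hstar (dniM a l) = 1%:M.
Proof.
move=> ha hl; apply: mulmx1C; have := congr1 hstar (up_dniM n K v v_unit n_gt0 a l ha hl).
rewrite hstar1 hstarM; last 2 first.
- exact: inH_up.
- by apply: inH_commR; apply: inH_dni.
by rewrite hstar_up.
Qed.

Lemma Igen_prod l : \prod_(i <- l) Igen n K v i = v ^- size l *: \prod_(i <- l) T i.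
Proof.
rewrite /Igen prod_mxZ; congr (_ *: _).
by rewrite big_const_seq count_predT iter_mulr_1 exprVn.
Qed.

Lemma Ichain_up a l : Ichain n K v a (a + l) = v ^- l.+1 *: upM a l.+1.
Proof.
rewrite /Ichain /hpath; case: ifP => h.
  have -> : l = 0%N by lia.
  by rewrite addn0 subnn /= Igen_prod.
by rewrite addKn Igen_prod size_iota.
Qed.

Lemma Ichain_dn a l : Ichain n K v (a + l) a = v ^- l.+1 *: dnM a l.+1.
Proof. by rewrite /Ichain /hpath leq_addr addKn Igen_prod size_rev size_iota. Qed.

(** The m letters of a block release v^m, or v^(-m) when the block is inverted. *)
Definition iscal (b : bool) i : K := if b then q ^+ i * v ^+ m else v ^- m.
(** Here q^m comes from the action of [jm m], and q^i = v^(2i) from the 2i letters of c_(m,i). *)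
Definition cscal (b : bool) i : K := if b then 1 else q ^+ (m + i).

Lemma qmX_mul k (x : HA) : qm ^+ k * x = q ^+ k *: (x : 'M[K]_N).
Proof. by rewrite qmX -mul_scalar_mx. Qed.

Lemma hstar_ifactor e i : (i < m)%N -> hstar (ifactor HA qm qim T m e i) =
  iscal (e i) i *: (if e i then Iplus n K v i.+1 (i + m) else Iminus n K v i.+1 (i + m)).
Proof.
move=> hi; have hl : (i.+1 + m <= n)%N by lia.
have ei : (i + m = i.+1 + m.-1)%N by lia.
have em : m = m.-1.+1 by lia.
rewrite /ifactor /iscal; case: (e i).
  rewrite qmX_mul hstarZ hstar_dn // /Iplus ei Ichain_up -em scalerA.
  by rewrite -mulrA divrr ?unitrX // mulr1.
rewrite /Iminus ei Ichain_dn -em.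
have E : (v ^- m *: dnM i.+1 m) *m (v ^+ m *: hstar (dniM i.+1 m)) = 1%:M.
  by rewrite -scalemxAl -scalemxAr scalerA mulVr ?unitrX // scale1r hstar_dni_dn.
by rewrite (invmx_eq _ _ _ _ E) scalerA mulVr ?unitrX // scale1r.
Qed.

Lemma hstar_cfactor e i : (i < m)%N -> hstar (cfactor HA qm T m e i) =
  cscal (e i) i *: (if e i then 1 else cm n K v m i).
Proof.
move=> hi; rewrite /cfactor /cscal; case: (e i); first by rewrite scale1r hstar1.
rewrite qmX_mul hstarZ hstarM; last 2 first.
- by apply: inH_dn; lia.
- by apply: inH_commR; apply: inH_up; lia.
rewrite hstar_up ?hstar_dn; [|lia..].
rewrite exprD -scalerA; congr (_ *: _); rewrite /cm.
case: i hi => [|i] hi /=; first by rewrite expr0 scale1r dn0 up0 (@mulr1 HA).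
have -> : (m + i.+1 = m + 1 + i)%N by lia.
rewrite Ichain_dn Ichain_up mxZl mxZr !scalerA addn1 -mulrA -invrM ?unitrX //.
by rewrite -exprD addnn -mul2n exprM divrr ?scale1r // unitrX // q_unit.
Qed.

Lemma sub_ifactor e i : (i < m)%N -> inH (ifactor HA qm qim T m e i).
Proof.
move=> hi; apply: sub_inH.
exact: (subA_ifactor HA n qm qim (scalar_set n K) T (scalar_q n K v) (scalar_qi n K v)
  (scalar_1 n K) (scalar_opp n K) n_gt0 (T_braid0M n K v) m e n_eq m_gt0).
Qed.

Lemma sub_cfactor e i : (i < m)%N -> inH (cfactor HA qm T m e i).
Proof.
move=> hi; apply: sub_inH.
exact: (subA_cfactor HA n qm (scalar_set n K) T (scalar_q n K v) n_gt0 (T_braid0M n K v)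
  m e n_eq m_gt0).
Qed.

Lemma inH_prod_nat (F : nat -> 'M[K]_N) :
  (forall i, (i < m)%N -> inH (F i)) -> inH (\prod_(0 <= i < m) F i).
Proof. by move=> h; apply: inH_prod => i; rewrite mem_index_iota; apply: h. Qed.

Lemma inH_straight e : inH (straight HA qm qim T m e).
Proof.
apply: inHM; apply: inH_prod_nat => i; [exact: sub_cfactor | exact: sub_ifactor].
Qed.

(** The exponent is the sum of 2i + m over i < m, that is m(m-1) + m^2. *)
Lemma prod_scal : \prod_(k < m) (q ^+ (m - 1 - k) * v ^+ m) = v ^+ (m * (2 * m - 1)).
Proof.
rewrite (reindex_inj rev_ord_inj) /=.
have -> : \prod_(k < m) (q ^+ (m - 1 - (m - k.+1)) * v ^+ m) =
          \prod_(k < m) v ^+ (2 * k + m).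
  apply: eq_bigr => k _; have hk := ltn_ord k.
  have -> : (m - 1 - (m - k.+1) = k)%N by lia.
  by rewrite -exprM -exprD.
have H j : \prod_(k < j) v ^+ (2 * k + m) = v ^+ (j * (j - 1) + j * m).
  elim: j => [|j ih]; first by rewrite big_ord0.
  by rewrite big_ord_recr /= ih -exprD; congr (v ^+ _); nia.
by rewrite H; congr (v ^+ _); nia.
Qed.

(** Since [hstar] reverses products, the sign of 0-based index k governs the factor of index
    m-1-k. *)
Definition rev_eps (eps : {ffun 'I_m -> bool}) : {ffun 'I_m -> bool} :=
  [ffun k => eps (rev_ord k)].

Lemma rev_epsK : involutive rev_eps.
Proof. by move=> eps; apply/ffunP => k; rewrite !ffunE rev_ordK. Qed.

Lemma hstar_straight eps : hstar (straight HA qm qim T m (ffun_nat m eps)) =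
  v ^+ (m * (2 * m - 1)) *: (Ieps n K v m (rev_eps eps) * Ceps n K v m (rev_eps eps)).
Proof.
have er (k : 'I_m) : ffun_nat m eps (m - 1 - k) = rev_eps eps k.
  have -> : (m - 1 - k = rev_ord k)%N by have := ltn_ord k; rewrite /=; lia.
  by rewrite ffun_natE ffunE.
rewrite hstarM; last 2 first.
- by apply: inH_prod_nat => i; apply: sub_cfactor.
- by apply: inH_commR; apply: inH_prod_nat => i; apply: sub_ifactor.
rewrite !hstar_prod_nat; [|by move=> i; apply: sub_cfactor|by move=> i; apply: sub_ifactor].
under eq_bigr => k _.
  rewrite hstar_ifactor; last by have := ltn_ord k; lia.
  rewrite er. over.
under [X in _ * X]eq_bigr => k _.
  rewrite hstar_cfactor; last by have := ltn_ord k; lia.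
  rewrite er. over.
rewrite !prod_mxZ mxZl mxZr scalerA -big_split /=; congr (_ *: _); last congr (_ * _).
- rewrite -prod_scal; apply: eq_bigr => k _; rewrite /iscal /cscal.
  case: (rev_eps eps k); first by rewrite mulr1.
  (* This makes the scalar of a minus sign equal to that of a plus sign. *)
  have e : v ^- m * q ^+ m = v ^+ m.
    by rewrite /Defs.q -exprM mul2n -addnn exprD mulrA mulVr ?unitrX ?mul1r.
  by rewrite exprD mulrA e mulrC.
- apply: eq_bigr => k _; have hk := ltn_ord k.
  have -> : ((m - 1 - k).+1 = m - k)%N by lia.
  by have -> : (m - 1 - k + m = 2 * m - 1 - k)%N by lia.
- rewrite /Ceps [RHS]big_mkcond; apply: eq_bigr => k _.
  by case: (rev_eps eps k).
Qed.

Definition hmm : HA := \sum_(eps : {ffun 'I_m -> bool}) straight HA qm qim T m (ffun_nat m eps).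

Lemma inH_hmm : inH hmm.
Proof.
apply: (big_ind inH).
- by have := inHZ n K v 0 _ (inH1 n K v); rewrite scale0r.
- exact: inHD.
- by move=> eps _; apply: inH_straight.
Qed.

Lemma hstar_hmm : hstar hmm = v ^+ (m * (2 * m - 1)) *:
  \sum_(eps : {ffun 'I_m -> bool}) Ieps n K v m eps * Ceps n K v m eps.
Proof.
rewrite hstar_sum scaler_sumr (reindex_inj (inv_inj rev_epsK)) /=.
by apply: eq_bigr => eps _; rewrite hstar_straight rev_epsK.
Qed.

(** The concatenated blocks form a reduced word of w_(m,m), and both sides lie in the commutant. *)
Lemma Tw_wmm : Tw n K v (wmm n m) = rest HA T m 0.
Proof.
have -> : rest HA T m 0 = \prod_(i <- block_word m 0) T i.
  rewrite /rest /block_word subn0 big_flatten /= big_map /index_iota subn0.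
  by [].
apply: commR_ext.
- exact: commR_Tw.
- by apply: commR_Tword; apply: block_word_lt.
have [hr _] := block_wordP m 0 (leq0n m).
by rewrite Tw_bv Tword_bv ?wprod_wmm // block_word_lt.
Qed.

Lemma hmm_ideal : inJ n K v m
  (uplus n K v m * Tw n K v (wmm n m) * uminus n K v m - uplus n K v m * hmm).
Proof.
apply/inJ_ideal; rewrite uplus_ujm uminus_jm Tw_wmm.
exact: (straighten_sum HA n qm qim (scalar_set n K) T (scalar_central n K) (scalar_q n K v)
  (scalar_qi n K v) (scalar_1 n K) (scalar_opp n K) n_gt0 (qqiM n K v v_unit)
  (T0_sqM n K v n_gt0) (T_sqM n K v) (T_farM n K v) (T_braidM n K v) (T_braid0M n K v)
  m n_eq m_gt0).
Qed.

Lemma straight_unique h h' : inH h -> inH h' ->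
  inJ n K v m (uplus n K v m * Tw n K v (wmm n m) * uminus n K v m - uplus n K v m * h) ->
  inJ n K v m (uplus n K v m * Tw n K v (wmm n m) * uminus n K v m - uplus n K v m * h') ->
  h = h'.
Proof.
set X := _ * _ * _; rewrite uplus_ujm => hh hh' /inJ_ideal j /inJ_ideal j'.
apply/eqP; rewrite -subr_eq0; apply/eqP.
have hm : (m <= n)%N by lia.
apply: (ujm_inH_ideal_eq0 n K v v_unit n_gt0 m _ hm).
  by apply: inHD => //; rewrite -scaleN1r; apply: inHZ.
have -> : ujm HA qm T m * (h - h') =
    (X - ujm HA qm T m * h') + - (X - ujm HA qm T m * h) :> HA.
  by rewrite mulrBr opprB [RHS]addrC addrA subrK.
apply: ujmI_add => //.
exact: (ujmI_opp HA n qm (scalar_set n K) T (scalar_1 n K) (scalar_opp n K)).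
Qed.
End Compute.

Theorem theorem6p8 (K : comUnitRingType) (v : K) (m : nat) :
  v \is a GRing.unit -> (0 < m)%N ->
  let n := (2 * m)%N in
  let prop (h : 'M[K]_#|{: W n}|) :=
    inJ n K v m (uplus n K v m * Tw n K v (wmm n m) * uminus n K v m
                 - uplus n K v m * h) in
  let RHS := v ^+ (m * (2 * m - 1)) *:
       \sum_(eps : {ffun 'I_m -> bool}) Ieps n K v m eps * Ceps n K v m eps in
  (exists h, inH n K v h /\ prop h) /\
  (forall h, inH n K v h -> prop h -> hstar n K v h = RHS).
Proof.
move=> hv hm n prop RHS; have h0 := inH_hmm m K v hv hm; have j0 := hmm_ideal m K v hv hm.
split; first by exists (hmm m K v).
by move=> h hh jh; rewrite (straight_unique m K v hv hm _ _ hh h0 jh j0) hstar_hmm.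
Qed.
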